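(* There is a number $N$ such that every connected strongly regular graph $G$ on $v>N$ vertices contains a Hamiltonian cycle.
   Context: A graph is strongly regular with parameters $(v,k,\lambda,\mu)$ if it is a $k$-regular graph on $v$ vertices such that each edge lies in exactly $\lambda$ triangles and any two distinct non-adjacent vertices have exactly $\mu$ common neighbours. Complete graphs and empty (edgeless) graphs are excluded from being strongly regular. *)

(* Defs.v *)
From mathcomp Require Import all_boot.
Set Implicit Arguments. Unset Strict Implicit. Unset Printing Implicit Defensive.

Definition simple_graph (T : finType) (e : rel T) : Prop :=
  symmetric e /\ irreflexive e.

Definition srg (T : finType) (e : rel T) (v k lam mu : nat) : Prop :=
  simple_graph e /\
  #|T| = v /\
  (forall x : T, #|[set y | e x y]| = k) /\
  (forall x y : T, e x y -> #|[set z | e x z && e y z]| = lam) /\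
  (forall x y : T, x != y -> ~~ e x y -> #|[set z | e x z && e y z]| = mu) /\
  (* not complete *) (exists x y : T, x != y /\ ~~ e x y) /\
  (* not empty (edgeless) *) (exists x y : T, e x y).

Definition strongly_regular (T : finType) (e : rel T) : Prop :=
  exists k lam mu, srg e #|T| k lam mu.

Definition connected_graph (T : finType) (e : rel T) : Prop :=
  forall x y : T, connect e x y.

Definition hamiltonian_cycle (T : finType) (e : rel T) (s : seq T) : Prop :=
  [/\ uniq s, (forall x : T, x \in s), 3 <= size s & cycle e s].

Definition hamiltonian (T : finType) (e : rel T) : Prop :=
  exists s : seq T, hamiltonian_cycle e s.

(* Main.v *)
Require Import Defs.
From mathcomp Require Import all_boot all_order all_algebra ring lra zify.
From mathcomp Require Import realalg.
Set Implicit Arguments. Unset Strict Implicit. Unset Printing Implicit Defensive.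
Import Order.TTheory GRing.Theory Num.Theory.

(** Let [r >= 0] and [- m < 0] be the nontrivial eigenvalues, so that [k = mu + r m],
    [lam = mu + r - m] and [mu v = (k - r) (k + m)].

    If [mu > m - 1], Hoffman's bound shows that independent sets have at most [k]
    vertices, and every separator has at least [k] vertices: of two sets without
    edges between them one has average degree at most [r], and counting paths of
    length two then bounds its boundary from below. The Chvatal-Erdos argument
    applies.

    Otherwise the graph is not a conference graph, so [r] and [m] are integers.
    The Krein condition gives [m - 1 <= (r + 1)^2], and a count in the neighbourhood
    of a vertex gives [r <= 4 m^2 mu]. Hence both are large when [v] is, so that all
    nontrivial eigenvalues are small compared to [k], and the graph is pseudo-random
    enough for Posa rotations to close a longest path into a Hamiltonian cycle. *)

(** * The Chvatal-Erdos condition *)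

(** The threshold [mu > m - 1] is exactly where Hoffman's bound drops below [k + 1]; conference
    graphs satisfy [m (m - 1) = mu] and so lie on this side. On the other side the obstacle is
    sparseness. As [mu v] has order [k^2], the degree can be far below [v], while the set [B] of
    vertices with too few neighbours in some block is only known to have [O(v / q)] elements, where
    [q = min(r, m)^2]. One rotation yields only [k] new ends, perhaps all in [B]; two rotations
    reach order [q k] vertices, which escapes [B] once [k q^2] is a large multiple of [v]. By
    [mu v <= 2 k^2] it is enough that [mu q^2] is a large multiple of [k]: for [r <= m] this comes
    from [m <= mu + r], for [m < r] from [r <= 4 m^2 mu]. No diagonalisation is used. The equation
    satisfied by the square of the adjacency matrix makes suitable combinations with the identity
    and the all-ones matrix multiples of idempotents, and sums of squares then give every spectral
    inequality. *)

Section ChvatalErdos.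
Variables (T : finType) (e : rel T).
Hypothesis esym : symmetric e.

(** An edge traversed back and forth counts as a cycle of size two, so a longest one exists as soon
    as there is an edge. *)
Definition longest_cycle (c : seq T) :=
  [/\ uniq c, cycle e c, 1 < size c &
      forall c', uniq c' -> cycle e c' -> size c' <= size c].

Lemma longest_cycle_exists (x y : T) :
  e x y -> x != y -> exists c, longest_cycle c.
Proof.
move=> exy nxy.
pose P n := [exists t : n.-tuple T, uniq t && cycle e t].
have P2 : P 2.
  apply/existsP; exists [tuple x; y].
  by rewrite /= inE nxy /= exy esym exy.
have ub n : P n -> n <= #|T|.
  case/existsP=> t /andP[ut _].
  by rewrite -(size_tuple t) -(card_uniqP ut) max_card.
case: (ex_maxnP (ex_intro P 2 P2) ub) => n /existsP[t /andP[ut ct]] nmax.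
exists t; split=> //; first by rewrite size_tuple nmax.
move=> c' uc' cc'; rewrite size_tuple; apply: nmax.
by apply/existsP; exists (in_tuple c'); rewrite uc' cc'.
Qed.

Lemma longest_cycle_rot (c : seq T) n : longest_cycle c -> longest_cycle (rot n c).
Proof.
case=> uc cc sc mc; split; rewrite ?rot_uniq ?rot_cycle ?size_rot //.
Qed.

Lemma longest_cycle_no_detour (c p : seq T) (y h : T) :
  longest_cycle c -> y \in c -> uniq (h :: p) -> path e h p ->
  {in h :: p, forall z, z \notin c} -> e y h -> ~~ e (last h p) (next c y).
Proof.
move=> lc yc up pp dis eyh; apply/negP=> eh.
case: (lc) => uc _ _ _; case: (rot_to yc) => i s cE.
have lr := longest_cycle_rot i lc; rewrite cE in lr.
case: lr => us cs ss ms; case: s cE us cs ss ms => [|z s] // cE us cs _ ms.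
have nE : next c y = z by rewrite -(next_rot i uc) cE /= eqxx.
have := ms (y :: (h :: p) ++ z :: s).
have -> : size (y :: (h :: p) ++ z :: s) <= size (y :: z :: s) = false.
  by rewrite /= size_cat /= !addnS !ltnS ltnNge leq_addl.
move=> H; apply: notF; apply: H.
  have pe : perm_eq (y :: (h :: p) ++ z :: s) ((h :: p) ++ (y :: z :: s)).
    by rewrite -cat1s perm_catCA.
  rewrite (perm_uniq pe) cat_uniq up us andbT andTb; apply/hasPn=> w wc.
  by apply/negP=> /dis; rewrite -(mem_rot i) cE wc.
move: cs; rewrite /= => /andP[_ ps].
by rewrite eyh rcons_cat cat_path pp /= -nE eh nE.
Qed.

Lemma next_cons2 (a b : seq T) (y z : T) :
  uniq (a ++ y :: z :: b) -> next (a ++ y :: z :: b) y = z.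
Proof. by move=> u; rewrite -(next_rot (size a) u) rot_size_cat /= eqxx. Qed.

Lemma next_rcons (a : seq T) (x y : T) :
  uniq (x :: rcons a y) -> next (x :: rcons a y) y = x.
Proof.
move=> u; rewrite -(next_rot (size (x :: a)) u) -rcons_cons -cats1.
by rewrite rot_size_cat /= eqxx.
Qed.

(** Otherwise the cycle could go from [y1] through the detour to [y2], back along the arc to the
    successor of [y1], jump to the successor of [y2] and continue, absorbing the detour. The
    condition on [next c y2] keeps that last successor distinct from [y1]. *)
Lemma longest_cycle_no_crossing (c p : seq T) (y1 y2 h : T) :
  longest_cycle c -> y1 \in c -> y2 \in c -> y1 != y2 ->
  uniq (h :: p) -> path e h p -> {in h :: p, forall z, z \notin c} ->
  e y1 h -> e (last h p) y2 -> next c y2 != y1 ->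
  ~~ e (next c y1) (next c y2).
Proof.
move=> lc y1c y2c ny up pp dis eyh ehy nn; apply/negP=> enn.
case: (lc) => uc _ _ _; case: (rot_to y1c) => i s cE.
have lr := longest_cycle_rot i lc; rewrite cE in lr.
case: lr => us cs ss ms.
have y2s : y2 \in s.
  by move: y2c; rewrite -(mem_rot i) cE inE eq_sym (negPf ny).
have dis' w : w \in h :: p -> w \notin y1 :: s.
  by move=> /dis; rewrite -(mem_rot i) cE.
rewrite -!(next_rot i uc) !cE in nn enn.
case/splitPr: y2s us cs dis' ms nn enn {cE ss} => a b us cs dis' ms nn enn.
case: b us cs dis' ms nn enn => [|z2 b] us cs dis' ms nn enn.
  by move: nn us; rewrite cats1 => nn us; rewrite next_rcons ?eqxx in nn.
have n2 : next (y1 :: a ++ [:: y2, z2 & b]) y2 = z2 by apply: (@next_cons2 (y1 :: a)).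
set z1 := next _ y1 in enn; rewrite n2 in enn.
have z1E : z1 = head y2 a by rewrite /z1; case: (a) => [|a1 a'] /=; rewrite eqxx.
have := ms (y1 :: (h :: p) ++ rev (rcons a y2) ++ z2 :: b).
have -> : size (y1 :: (h :: p) ++ rev (rcons a y2) ++ z2 :: b) <=
    size (y1 :: a ++ [:: y2, z2 & b]) = false.
  by rewrite /= !size_cat size_rev size_rcons /=; clear; lia.
move=> H; apply: notF; apply: H.
  have pe : perm_eq (y1 :: (h :: p) ++ rev (rcons a y2) ++ z2 :: b)
      ((h :: p) ++ (y1 :: a ++ [:: y2, z2 & b])).
    rewrite -cat1s perm_catCA perm_cat2l -[y1 :: a ++ _]cat1s perm_cat2l.
    by rewrite -(cat_rcons y2) perm_cat2r perm_rev.
  rewrite (perm_uniq pe) cat_uniq up us andbT andTb; apply/hasPn=> w wc.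
  by apply/negP=> /dis'; rewrite wc.
move: cs; rewrite /= rcons_cat cat_path /= => /and4P[pa ea _ pb].
rewrite eyh rcons_cat cat_path pp /= rcons_cat cat_path rev_rcons /=.
have -> : last y2 (rev a) = z1 by rewrite z1E; case: (a) => // *; rewrite rev_cons last_rcons.
rewrite ehy /= enn pb !andbT.
move: pa; case: (a) ea => [|a1 a'] //= ea /andP[_ pa'].
have := rev_path e a1 (rcons a' y2); rewrite last_rcons belast_rcons.
rewrite (eq_path (e' := e)) => [|x y]; last by rewrite /= esym.
by rewrite -cats1 cat_path pa' /= ea => ->.
Qed.

(** Let [H] be a component of what a longest cycle leaves out and [S] its attachments on the cycle.
    A vertex of [H] together with the successors of [S] is independent, so [S] has fewer than [k]
    elements, yet it separates [H] from the rest. *)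
Theorem hamiltonian_of_indep_le_connectivity (k : nat) :
  irreflexive e -> (exists x y : T, e x y) -> 3 <= #|T| ->
  (forall S : {set T}, {in S &, forall x y, ~~ e x y} -> #|S| <= k) ->
  (forall A B : {set T}, A != set0 -> B != set0 ->
     [disjoint A & B] -> {in A & B, forall x y, ~~ e x y} ->
     k <= #|~: (A :|: B)|) ->
  hamiltonian e.
Proof.
move=> eirr [x0 [y0 exy0]] T3 indep conn.
have nxy0 : x0 != y0 by apply: contraL exy0 => /eqP->; rewrite eirr.
have [c lc] := longest_cycle_exists exy0 nxy0.
case: (lc) => uc cc sc mc.
have [call|] := boolP [forall x, x \in c].
  exists c; split=> //; first by move=> x; apply: (forallP call).
  rewrite -(card_uniqP uc); apply: leq_trans T3 _; apply: subset_leq_card.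
  by apply/subsetP=> x _; apply: (forallP call).
rewrite negb_forall => /existsP[h hc].
pose e' := [rel x y | [&& e x y, x \notin c & y \notin c]].
have e'sym : connect_sym e'.
  apply: sym_connect_sym => x y /=; rewrite esym; congr (_ && _); exact: andbC.
pose H := [set x | connect e' h x].
have hH : h \in H by rewrite inE connect0.
have Hc x : x \in H -> x \notin c.
  rewrite inE => /connectP[p pp ->]; elim/last_ind: p pp => [|p z _] //=.
  by rewrite rcons_path last_rcons => /and4P[].
have HP x y : x \in H -> y \in H -> exists p,
    [/\ uniq (x :: p), path e x p, last x p = y & {in x :: p, forall z, z \notin c}].
  rewrite !inE => hx hy; have : connect e' x y by apply: connect_trans hy; rewrite e'sym.
  case/connectP=> p0 pp0 ->; case/shortenP: pp0 => p pp up _.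
  exists p; split=> //; first by apply: sub_path pp => u w /andP[].
  move=> z; rewrite inE => /predU1P[->|zp]; first by apply: Hc; rewrite inE.
  by case/splitPr: zp pp => p1 p2; rewrite cat_path /= => /and3P[_ /and3P[]].
have Hout x y : x \in H -> e x y -> y \notin H -> y \in c.
  move=> xH exy; apply: contraR => yc; rewrite inE; rewrite inE in xH.
  apply: (connect_trans xH); apply: connect1 => /=.
  by rewrite exy yc andbT; apply: Hc; rewrite inE.
pose S := [set y in c | [exists x in H, e y x]].
have SP y : y \in S -> y \in c /\ exists2 x, x \in H & e y x.
  by rewrite inE => /andP[-> /existsP[x /andP[xH exy]]]; split=> //; exists x.
have nextH y x : y \in S -> x \in H -> ~~ e x (next c y).
  move=> /SP[yc [h1 h1H eyh]] xH; have [p [up pp lp dp]] := HP _ _ h1H xH.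
  by rewrite -lp; apply: longest_cycle_no_detour.
have nextS y : y \in S -> next c y \notin S.
  move=> yS; apply/negP=> /SP[_ [x xH]]; rewrite esym; exact/negP/nextH.
pose I := h |: [set next c y | y in S].
have cardI : #|I| = #|S|.+1.
  rewrite cardsU1 card_imset; last exact: can_inj (prev_next uc).
  rewrite -add1n; case: imsetP => // -[y /SP[yc _] hE].
  by move: hc; rewrite hE mem_next yc.
have hnext y : y \in S -> ~~ e h (next c y) by move=> yS; apply: nextH.
have ltSk : #|S| < k.
  rewrite -cardI; apply: indep => x y.
  rewrite !in_setU1 => /predU1P[->|/imsetP[y1 y1S ->]] /predU1P[->|/imsetP[y2 y2S ->]].
  - by rewrite eirr.
  - exact: hnext.
  - by rewrite esym; apply: hnext.
  have [<-|ny] := eqVneq y1 y2; first by rewrite eirr.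
  case: (SP _ y1S) => y1c [h1 h1H e1]; case: (SP _ y2S) => y2c [h2 h2H e2].
  have [p [up pp lp dp]] := HP _ _ h1H h2H.
  apply: (longest_cycle_no_crossing (h := h1) (p := p)) => //.
    by rewrite lp esym.
  by apply: contraTneq y1S => <-; apply: nextS.
suff : k <= #|S| by rewrite leqNgt ltSk.
pose B := ~: (H :|: S).
have <- : ~: (H :|: B) = S.
  apply/setP=> x; rewrite !inE; case: (boolP (connect e' h x)) => //= hx.
    by rewrite (negPf (Hc x _)) // inE.
  by rewrite negbK.
apply: conn => //.
- by apply/set0Pn; exists h.
(* The far side is nonempty because, of a cycle vertex and its successor, one is outside [S]. *)
- have [y yc] : exists y, y \in c by case: (c) sc => // y s; exists y; rewrite inE eqxx.
  apply/set0Pn; have [yS|yS] := boolP (y \in S); [exists (next c y)|exists y].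
    rewrite in_setC in_setU negb_or nextS // andbT.
    by apply: contraL yc => /Hc; rewrite mem_next.
  by rewrite in_setC in_setU negb_or yS andbT; apply: contraL yc => /Hc.
- by rewrite -setI_eq0; apply/eqP/setP=> x; rewrite !inE; case: (connect _ _ _).
move=> x y xH; rewrite in_setC in_setU negb_or => /andP[yH yS].
apply: contra yS => exy; rewrite inE (Hout x) //=.
by apply/existsP; exists x; rewrite xH esym.
Qed.
End ChvatalErdos.

(** * Rotations of longest paths *)

Section Infix.
Variable T : eqType.
Implicit Types (s t p I : seq T) (x y z : T).

Lemma last_rev x s : last x (rev s) = head x s.
Proof. by case: s => // y s; rewrite rev_cons last_rcons. Qed.

Lemma head_rev x s : head x (rev s) = last x s.
Proof. by rewrite -last_rev revK. Qed.

Lemma infix_cat_cases I s t : infix I (s ++ t) ->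
  [\/ infix I s, infix I t |
      exists s' x y t', [/\ s = rcons s' x, t = y :: t', x \in I & y \in I]].
Proof.
case/infixP=> a [b E].
have [ltas|leas] := ltnP (size a) (size s); last first.
  constructor 2; apply/infixP; exists (drop (size s) a), b.
  have := congr1 (drop (size s)) E; rewrite drop_size_cat // => ->.
  rewrite drop_cat; case: ltngtP leas => // -> _.
  by rewrite subnn drop0 drop_size.
have [lts|leI] := ltnP (size s) (size a + size I); last first.
  constructor 1; apply/infixP; exists a, (take (size s - size a - size I) b).
  have := congr1 (take (size s)) E; rewrite take_size_cat // => {1}->.
  rewrite take_cat ltnNge (ltnW ltas) /= take_cat ifN //; lia.
constructor 3.
have sE : s = a ++ take (size s - size a) I.
  have := congr1 (take (size s)) E; rewrite take_size_cat // => {1}->.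
  rewrite take_cat ltnNge (ltnW ltas) /= take_cat ifT //; lia.
have tE : t = drop (size s - size a) I ++ b.
  have := congr1 (drop (size s)) E; rewrite drop_size_cat // => {1}->.
  rewrite drop_cat ltnNge (ltnW ltas) /= drop_cat ifT //; lia.
have IE := cat_take_drop (size s - size a) I.
move: sE tE IE; set I1 := take _ _; set I2 := drop _ _ => sE tE IE.
have s1 : 0 < size I1 by rewrite size_take; case: ifP; lia.
have s2 : 0 < size I2 by rewrite size_drop; lia.
case/lastP: I1 s1 sE IE => // I1 x _ sE IE; case: I2 s2 tE IE => // y I2 _ tE IE.
exists (a ++ I1), x, y, (I2 ++ b); split; rewrite ?rcons_cat //.
  by rewrite -IE mem_cat mem_rcons inE eqxx.
by rewrite -IE mem_cat inE eqxx orbT.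
Qed.

(** Rotations reverse segments, so the survival of a block is tracked up to reversal. For
    two-element lists this says that an edge is still on the path. *)
Definition intact I p := infix I p || infix (rev I) p.

Lemma intact_rev I p : intact I (rev p) = intact I p.
Proof. by rewrite /intact infix_rev -[X in infix X (rev p)]revK infix_rev orbC. Qed.

Lemma intact_mem I p x : intact I p -> x \in I -> x \in p.
Proof. by case/orP=> /mem_infix H xI; apply: H; rewrite ?mem_rev. Qed.

Lemma intact_catl I s t : intact I s -> intact I (s ++ t).
Proof. by case/orP=> h; apply/orP; [left|right]; apply: infix_catr. Qed.

Lemma intact_catr I s t : intact I t -> intact I (s ++ t).
Proof. by case/orP=> h; apply/orP; [left|right]; apply: infix_catl. Qed.

Lemma intact_trans I s t : infix I s -> intact s t -> intact I t.
Proof.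
move=> Is /orP[st|st]; apply/orP; [left|right]; first exact: infix_trans Is st.
by apply: infix_trans st; rewrite infix_rev.
Qed.

Lemma intact_cat_cases I s t : intact I (s ++ t) ->
  [\/ intact I s, intact I t |
      exists s' x y t', [/\ s = rcons s' x, t = y :: t', x \in I & y \in I]].
Proof.
case/orP=> /infix_cat_cases[h|h|[s' [x [y [t' h]]]]].
- by constructor 1; rewrite /intact h.
- by constructor 2; rewrite /intact h.
- by constructor 3; exists s', x, y, t'.
- by constructor 1; rewrite /intact h orbT.
- by constructor 2; rewrite /intact h orbT.
by constructor 3; exists s', x, y, t'; case: h; rewrite !mem_rev.
Qed.

(** The cut is made just before or just after the first block; it cannot break the second one, which
    shares no vertex with the first. *)
Lemma intact_split (I1 I2 p : seq T) : I1 != [::] -> I2 != [::] ->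
  {in I1, forall x, x \notin I2} -> intact I1 p -> intact I2 p ->
  exists p1 p2, p = p1 ++ p2 /\
    (intact I1 p1 /\ intact I2 p2 \/ intact I2 p1 /\ intact I1 p2).
Proof.
move=> n1 n2 dis i1 i2.
have [J JE [a [b pE]]] : exists2 J, J =i I1 /\ intact I1 J & exists a b, p = a ++ J ++ b.
  case/orP: i1 => /infixP[a [b E]]; [exists I1|exists (rev I1)]; try by exists a, b.
    by split=> //; rewrite /intact infix_refl.
  by split; [exact: mem_rev|rewrite /intact infix_refl orbT].
case: JE => JE iJ.
have nJ : J != [::].
  by apply: contra n1 => /eqP J0; case: (I1) JE => // x s /(_ x); rewrite J0 !inE eqxx.
rewrite pE in i2; case/intact_cat_cases: i2 => [h|h|].
- by exists a, (J ++ b); split=> //; right; split=> //; apply: intact_catl.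
- case/intact_cat_cases: h => [h|h|].
  + case: (I2) n2 dis h => // x s _ dis /intact_mem/(_ (mem_head _ _)).
    by rewrite JE => /dis; rewrite mem_head.
  + exists (a ++ J), b; rewrite -catA; split=> //; left; split=> //; exact: intact_catr.
  case=> s' [x [y [t' [JE' _ xI _]]]]; have /negP[] // : x \notin I2.
  by apply: dis; rewrite -JE JE' mem_rcons mem_head.
case=> s' [x [y [t' [_ JE' _ yI]]]]; have /negP[] // : y \notin I2.
by apply: dis; case: (J) nJ JE JE' => // z J' _ JE [zy _]; rewrite -JE zy mem_head.
Qed.
End Infix.

Section Rotation.
Variables (T : finType) (e : rel T) (x0 : T).
Hypothesis esym : symmetric e.
Implicit Types (s t p I : seq T) (x y z : T).

Lemma sorted_rev p : sorted e (rev p) = sorted e p.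
Proof.
rewrite rev_sorted; case: p => //= x p; apply: eq_path => u w /=; exact: esym.
Qed.

Lemma sorted_catE s t : s != [::] -> t != [::] ->
  sorted e (s ++ t) = [&& sorted e s, e (last x0 s) (head x0 t) & sorted e t].
Proof. by case: s => // x s; case: t => // y t _ _ /=; rewrite cat_path. Qed.

Lemma rotation s t y z : sorted e (s ++ y :: z :: t) -> e (last z t) y ->
  sorted e (s ++ y :: rev (z :: t)).
Proof.
move=> h ey; have := h; rewrite -!(cat_rcons y).
have ns : rcons s y != [::] by case: (s).
have nr : rev (z :: t) != [::] by rewrite -size_eq0 size_rev.
rewrite !sorted_catE //.
by rewrite sorted_rev last_rcons head_rev /= (esym y (last z t)) ey => /and3P[-> _ ->].
Qed.

Lemma rotation_perm s t y : perm_eq (s ++ y :: rev t) (s ++ y :: t).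
Proof. by rewrite perm_cat2l perm_cons perm_rev. Qed.

Lemma rotation_last s t y z : last x0 (s ++ y :: rev (z :: t)) = z.
Proof. by rewrite last_cat /= last_rev. Qed.

Lemma rotation_head s t t' y : head x0 (s ++ y :: t) = head x0 (s ++ y :: t').
Proof. by case: s. Qed.

(** The only link that a rotation removes joins the pivot [y] to its successor. *)
Lemma rotation_intact I s t y : intact I (s ++ y :: t) ->
  intact I (s ++ y :: rev t) \/ y \in I /\ head x0 t \in I.
Proof.
rewrite -!(cat_rcons y) => /intact_cat_cases[h|h|].
- by left; apply: intact_catl.
- by left; apply: intact_catr; rewrite intact_rev.
case=> s' [x [w [t' [E -> xI wI]]]]; right; split=> //.
by case/rcons_inj: E => _ ->.
Qed.

Lemma uniq_split s s' t t' y : uniq (s ++ y :: t) ->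
  s ++ y :: t = s' ++ y :: t' -> s = s' /\ t = t'.
Proof.
move=> u E; have u' := u; rewrite E in u'.
have ix r r' : uniq (r ++ y :: r') -> index y (r ++ y :: r') = size r.
  rewrite cat_uniq => /and3P[_ /hasPn/(_ y (mem_head _ _)) yr _].
  by rewrite index_cat (negPf yr) /= eqxx addn0.
have : size s = size s' by rewrite -(ix _ _ u) E ix.
by move=> ss; move/eqP: E; rewrite eqseq_cat // => /andP[/eqP-> /eqP[->]].
Qed.

Lemma intact_pair_cases s t y z w : uniq (s ++ y :: z :: t) ->
  intact [:: y; w] (s ++ y :: z :: t) -> w = z \/ w = last z s.
Proof.
move=> u; case/orP=> /infixP[a [b]]; rewrite /rev /= => E.
  by case: (uniq_split u E) => _ [-> _]; left.
rewrite -(cat_rcons w) in E; case: (uniq_split u E) => -> _; right.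
by rewrite last_rcons.
Qed.

(* Posa's lemma, with pivots restricted to [Int]. An edge of [L] is lost only when
   one of its ends becomes an endpoint, so a pivot that is not next to [S] on [L]
   still has its two neighbours along [L]. *)
Lemma rotation_closure (L : seq T) (Core Int : {set T}) (f g : T -> T) :
  L != [::] -> uniq L -> sorted e L ->
  {in Int, forall y, [/\ intact [:: y; f y] L, intact [:: y; g y] L, f y != g y,
                        f y \in Core & g y \in Core]} ->
  exists S : {set T}, [/\ last x0 L \in S, S \subset last x0 L |: Core,
    {in S, forall x, exists L', [/\ perm_eq L' L, sorted e L',
                        head x0 L' = head x0 L & last x0 L' = x]} &
    {in S & Int, forall x y, e x y -> [|| y \in S, f y \in S | g y \in S]}].
Proof.
move=> L0 uL sL hInt.
pose Inv (S : {set T}) := [/\ last x0 L \in S, S \subset last x0 L |: Core &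
  {in S, forall x, exists L', [/\ perm_eq L' L, sorted e L',
    head x0 L' = head x0 L, last x0 L' = x &
    forall u w, intact [:: u; w] L -> u \notin S -> w \notin S ->
      intact [:: u; w] L']}].
suff main n (S : {set T}) : #|~: S| <= n -> Inv S -> exists S', Inv S' /\
    {in S' & Int, forall x y, e x y -> [|| y \in S', f y \in S' | g y \in S']}.
  have [|S [[bS sS hS] cS]] := main _ [set last x0 L] (leqnn _).
    split; rewrite ?set11 ?sub1set ?setU11 // => x /set1P->.
    by exists L; split.
  exists S; split=> // x /hS[L' [pL sL' hL lL _]]; by exists L'.
elim: n S => [|n IH] S leS iS.
  exists S; split=> // x y _ _ _; suff -> : y \in S by [].
  by move: leS; rewrite leqn0 cards_eq0 => /eqP/setP/(_ y); rewrite !inE => /negbFE.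
have [cl|] := boolP [forall x in S, forall y in Int,
    e x y ==> [|| y \in S, f y \in S | g y \in S]].
  exists S; split=> // x y xS yI exy.
  by move/forall_inP: cl => /(_ x xS)/forall_inP/(_ y yI); rewrite exy.
case/forall_inPn=> x xS /forall_inPn[y yI]; rewrite negb_imply !negb_or.
case/and4P=> exy yS fS gS; case: (iS) => bS sS hS.
have [L' [pL sL' hL lL kL]] := hS x xS.
have [if_ ig nfg fC gC] := hInt y yI.
have yL : y \in L' by rewrite (perm_mem pL); apply: (intact_mem if_); apply: mem_head.
have uL' : uniq L' by rewrite (perm_uniq pL).
have if' := kL _ _ if_ yS fS; have ig' := kL _ _ ig yS gS.
case/splitPr: yL pL sL' uL' hL lL kL if' ig' => s t pL sL' uL' hL lL kL if' ig'.
case: t pL sL' uL' hL lL kL if' ig' => [|z t] pL sL' uL' hL lL kL if' ig'.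
  by move: yS; rewrite last_cat /= in lL; rewrite lL xS.
(* Both [f y] and [g y] are still next to [y] on [L'] and only one of them can precede it, so the
   successor [z], which becomes the new end, is the other one and lies in [Core]. *)
have zfg : z = f y \/ z = g y.
  case: (intact_pair_cases uL' if') => [|fE]; first by left.
  case: (intact_pair_cases uL' ig') => [|gE]; first by right.
  by move: nfg; rewrite fE gE eqxx.
have zS : z \notin S by case: zfg => ->.
have zC : z \in Core by case: zfg => ->.
apply: (IH (z |: S)).
  by move: leS; rewrite (cardsD1 z) in_setC zS add1n ltnS setCU setIC -setDE.
split.
- by rewrite in_setU1 bS orbT.
- by rewrite subUset sub1set in_setU1 zC orbT.
move=> w /setU1P[->|wS]; last first.
  have [L1 [pL1 sL1 hL1 lL1 kL1]] := hS w wS; exists L1; split=> // u1 w1 i1.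
  by rewrite !in_setU1 !negb_or => /andP[_ ?] /andP[_ ?]; apply: kL1.
exists (s ++ y :: rev (z :: t)); split.
- by apply: perm_trans pL; apply: rotation_perm.
- by apply: rotation => //; rewrite -lL last_cat /= in exy *.
- by rewrite -hL; apply: rotation_head.
- exact: rotation_last.
move=> u1 w1 i1; rewrite !in_setU1 !negb_or => /andP[uz uS] /andP[wz wS].
case: (rotation_intact (kL _ _ i1 uS wS)) => // -[_] /=.
by rewrite !inE eq_sym (negPf uz) eq_sym (negPf wz).
Qed.
End Rotation.

Section LongestPath.
Variables (T : finType) (e : rel T) (x0 : T).
Hypotheses (esym : symmetric e) (eirr : irreflexive e).
Implicit Types (p I : seq T) (A B S : {set T}).

Definition longest_path p :=
  [/\ uniq p, sorted e p & forall p', uniq p' -> sorted e p' -> size p' <= size p].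

Lemma longest_path_exists : exists2 p, longest_path p & p != [::].
Proof.
pose P n := [exists t : n.-tuple T, uniq t && sorted e t].
have P1 : P 1 by apply/existsP; exists [tuple x0].
have ub n : P n -> n <= #|T|.
  case/existsP=> t /andP[ut _].
  by rewrite -(size_tuple t) -(card_uniqP ut) max_card.
case: (ex_maxnP (ex_intro P 1 P1) ub) => n /existsP[t /andP[ut st]] nmax.
exists t; last by rewrite -size_eq0 size_tuple -lt0n nmax.
split=> // p' up' sp'; rewrite size_tuple; apply: nmax.
by apply/existsP; exists (in_tuple p'); rewrite up' sp'.
Qed.

Lemma longest_path_perm p p' :
  longest_path p -> perm_eq p' p -> sorted e p' -> longest_path p'.
Proof.
move=> [up sp mp] pp sp'; split=> //; first by rewrite (perm_uniq pp).
by rewrite (perm_size pp).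
Qed.

Lemma longest_path_rev p : longest_path p -> longest_path (rev p).
Proof.
move=> lp; case: (lp) => _ sp _; apply: longest_path_perm lp _ _.
  by rewrite perm_rev.
by rewrite sorted_rev.
Qed.

Lemma longest_path_last p y :
  longest_path p -> p != [::] -> e (last x0 p) y -> y \in p.
Proof.
move=> [up sp mp] p0 ey; apply: contraT => yp.
have := mp (rcons p y); rewrite rcons_uniq yp up size_rcons ltnn -cats1.
by rewrite (sorted_catE e x0) // sp ey => /(_ isT isT).
Qed.

(** If the cycle is not spanning, some edge leaves it; opening the cycle at that edge gives a longer
    path. *)
Lemma longest_path_cycle p c : connected_graph e -> longest_path p ->
  perm_eq c p -> c != [::] -> cycle e c -> forall x, x \in c.
Proof.
move=> conn [up sp mp] pc c0 cc x; apply: contraT => xc.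
have uc : uniq c by rewrite (perm_uniq pc).
have [u [w [uc' wc euw]]] : exists u w, [/\ u \in c, w \notin c & e u w].
  have [z zc] : exists z, z \in c by case: (c) c0 => // z s _; exists z; rewrite mem_head.
  case/connectP: (conn z x) => q; elim: q z zc => [|w q IH] z zc /=.
    by move=> _ E; rewrite E zc in xc.
  case/andP=> ezw pq E; have [wc|wc] := boolP (w \in c); last by exists z, w.
  exact: IH wc pq E.
case: (rot_to uc') => i s cE.
have := mp (w :: u :: s).
have -> : size (w :: u :: s) <= size p = false.
  by rewrite -(perm_size pc) -(size_rot i c) cE /= ltnn.
move=> H; apply: H.
  by rewrite cons_uniq -cE mem_rot wc rot_uniq.
move: cc; rewrite -(rot_cycle i) cE /= rcons_path => /andP[ps _].
by rewrite esym euw.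
Qed.

(* The first rotation reaches at least [k] endpoints, the second one all vertices
   next to their neighbourhood on [p], which is larger than [B]. *)
Lemma two_rotations (k q : nat) p B : longest_path p -> p != [::] ->
  (forall x, #|[set y | e x y]| = k) ->
  (forall S S' : {set T}, {in S, forall x y, e x y -> y \in S'} ->
     2 * #|S'| <= #|T| -> q * #|S| <= 4 * #|S'|) ->
  2 * (2 * #|B| + k) < #|T| -> 4 * (2 * #|B| + k) < q * k ->
  exists p' piv, [/\ size piv = 2, perm_eq p' p, sorted e p',
    head x0 p' = head x0 p /\ last x0 p' \notin B &
    forall I, {in piv, forall y, y \notin I} -> intact I p -> intact I p'].
Proof.
move=> lp p0 deg expand ltT ltq; case: (lp) => up sp _.
set b := last x0 p.
pose N x := [set y | e x y].
pose S1 := [set next p y | y in N b].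
pose S2 := [set z | [exists x in S1, e x z]].
have cS1 : #|S1| = k by rewrite card_imset ?deg //; apply: can_inj (prev_next up).
have cS2 : 2 * #|B| + k < #|S2|.
  have := expand S1 S2; rewrite cS1.
  have [le1|] := leqP (2 * #|S2|) #|T|; last by lia.
  move=> /(_ _ isT) H; have : q * k <= 4 * #|S2|; last by lia.
  apply: H => x xS y exy; rewrite inE; apply/existsP; exists x; exact/andP.
(* Avoiding [N b] makes the second pivot [z] differ from the first pivot [y]. The end created by
   pivoting at [z] is [next p z] or [prev p z], according to whether [z] lies before [y] or in the
   reversed part, so both must stay out of [B]. *)
pose W := N b :|: ((prev p @: B) :|: (next p @: B)).
have : ~~ (S2 \subset W).
  apply/negP=> /subset_leq_card; apply/negP; rewrite -ltnNge.
  apply: leq_ltn_trans cS2; rewrite addnC.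
  apply: leq_trans (leq_card_setU _ _) _; rewrite deg leq_add2l mul2n -addnn.
  by apply: leq_trans (leq_card_setU _ _) _; apply: leq_add; apply: leq_imset_card.
case/subsetPn=> z; rewrite inE => /existsP[x /andP[/imsetP[y yb xE] exz]].
rewrite !in_setU !negb_or => /and3P[zb znB zpB].
have nzB : next p z \notin B.
  by apply: contra znB => h; apply/imsetP; exists (next p z); rewrite ?prev_next.
have pzB : prev p z \notin B.
  by apply: contra zpB => h; apply/imsetP; exists (prev p z); rewrite ?next_prev.
rewrite inE in yb; rewrite inE in zb.
have yp : y \in p by apply: longest_path_last yb.
have zy : z != y by apply: contraNneq zb => ->.
have zx : z != x by apply: contraTneq exz => ->; rewrite eirr.
case/splitPr E: {-}_ / yp => [s [|x' t]].
  by move: yb; rewrite /b E last_cat /= eirr.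
have xx' : x' = x by rewrite xE E next_cons2 // -E.
move: E; rewrite {x'}xx' => E.
have ebl : e (last x t) y by move: yb; rewrite /b E last_cat.
have sp1 : sorted e (s ++ y :: rev (x :: t)) by apply: rotation => //; rewrite -E.
have pp1 : perm_eq (s ++ y :: rev (x :: t)) p by rewrite E rotation_perm.
have lp1 := longest_path_perm lp pp1 sp1.
have ip1 I : y \notin I -> intact I p -> intact I (s ++ y :: rev (x :: t)).
  rewrite {1}E => yI ip; case: (rotation_intact x0 ip) => // -[yI'].
  by rewrite yI' in yI.
have n1 : s ++ y :: rev (x :: t) != [::] by case: (s).
have zp1 : z \in s ++ y :: rev (x :: t).
  by apply: (longest_path_last lp1 n1); rewrite rotation_last.
suff [s' [w [t' [E1 wB]]]] : exists s' w t',
    s ++ y :: rev (x :: t) = s' ++ z :: w :: t' /\ w \notin B.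
  have l1 : last w t' = x.
    by have := rotation_last x0 s t y x; rewrite E1 last_cat.
  exists (s' ++ z :: rev (w :: t')), [:: y; z]; split=> //.
  - by rewrite (perm_trans _ pp1) // E1 rotation_perm.
  - by apply: rotation => //; rewrite -?E1 // l1.
  - split; last by rewrite rotation_last.
    rewrite (rotation_head x0 s' _ (w :: t')) -E1 E; exact: rotation_head.
  move=> I hI iI; have yI : y \notin I by apply: hI; rewrite !inE eqxx.
  have zI : z \notin I by apply: hI; rewrite !inE eqxx orbT.
  have := ip1 _ yI iI; rewrite E1 => ip; case: (rotation_intact x0 ip) => // -[zI'].
  by rewrite zI' in zI.
move: zp1; rewrite mem_cat inE (negPf zy) /= mem_rev inE (negPf zx) /=.
case/orP=> [zs|zt].
  case/splitPr: zs E {sp1 pp1 lp1 ip1 n1} => s1 s2 E.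
  rewrite -catA /=; exists s1; case: s2 E => [|w s2] E /=.
    exists y, (rev (x :: t)); split=> //; move: nzB.
    by rewrite E -catA /= next_cons2 //; move: up; rewrite E -catA.
  exists w, (s2 ++ y :: rev (x :: t)); split=> //; move: nzB.
  by rewrite E -catA /= next_cons2 //; move: up; rewrite E -catA.
case/splitPr: zt E {sp1 pp1 lp1 ip1 n1 ebl} => t1 t2 E.
exists (s ++ y :: rev t2), (last x t1), (rev (belast x t1)); split.
  by rewrite -[x :: t1 ++ _]cat_cons rev_cat (rev_cons z) (lastI x t1) rev_rcons cat_rcons -catA.
have E' : p = (s ++ y :: belast x t1) ++ last x t1 :: z :: t2.
  by rewrite E -catA /= -(cat_rcons (last x t1)) -lastI.
suff -> : last x t1 = prev p z by [].
by rewrite -[LHS](prev_next up) {2}E' next_cons2 -?E'.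
Qed.
End LongestPath.

(** * Pseudo-random graphs *)

Lemma card_setU_le (T : finType) (A B : {set T}) : #|A :|: B| <= #|A| + #|B|.
Proof. exact: leq_card_setU. Qed.

Section PseudoRandom.
Variables (T : finType) (e : rel T) (x0 : T).
Hypothesis esym : symmetric e.
Variables (k q : nat).
Hypothesis deg : forall x, #|[set y | e x y]| = k.
Implicit Types (p I L : seq T) (A B S : {set T}).

Definition deg_in A x := #|[set y in A | e x y]|.

(** For [A] of density at least [1 / c] the mean of [deg_in A x] is at least [k / c], and [S]
    collects vertices below half of that; [mixing_upper] concerns vertices at or above twice the
    mean. Chebyshev's inequality gives both for any [q] up to [(k / M)^2], where [M] bounds the
    nontrivial eigenvalues in absolute value. *)
Definition mixing_lower := forall (c : nat) (S A : {set T}),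
  {in S, forall x, 2 * c * deg_in A x < k} -> #|T| <= c * #|A| ->
  q * #|S| <= 4 * c * #|T|.

Definition mixing_upper := forall (c : nat) (S A : {set T}),
  {in S, forall x, k <= c * deg_in A x} -> 2 * c * #|A| <= #|T| ->
  q * #|S| <= 4 * c ^ 2 * #|A|.

Hypotheses (mixl : mixing_lower) (mixu : mixing_upper).
Hypothesis q_large : 200 * 1000 <= q.

(** [next] and [prev] are cyclic, so the ends of [I] are dropped to make them true neighbours along
    the path. Since these avoid [B], so does every end created by pivoting at such a vertex. *)
Definition inner I B := [set y | [&& y \in I, y != head x0 I, y != last x0 I,
                                   next I y \notin B & prev I y \notin B]].

Lemma innerP I B y : uniq I -> y \in inner I B ->
  [/\ intact [:: y; next I y] I, intact [:: y; prev I y] I,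
      next I y != prev I y, next I y \in ~: B & prev I y \in ~: B].
Proof.
move=> uI; rewrite !inE => /and5P[yI yh yl nB pB].
suff [s [u [w [t [E nE pE]]]]] : exists s u w t,
    [/\ I = s ++ [:: u; y; w] ++ t, next I y = w & prev I y = u].
  rewrite nE pE -nE nB nE -pE pB pE; split=> //.
  - by apply/orP; left; apply/infixP; exists (s ++ [:: u]), t; rewrite E -catA.
  - by apply/orP; right; apply/infixP; exists s, (w :: t); rewrite E.
  move: uI; rewrite E /= cat_uniq => /and3P[_ _] /= /andP[].
  by rewrite !inE !negb_or (eq_sym w u) => /and3P[_ -> _].
case/splitPr: yI uI yh yl nB pB => s t uI yh yl nB pB.
case/lastP: s uI yh yl nB pB => [|s u] uI yh yl nB pB; first by rewrite /= eqxx in yh.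
case: t uI yh yl nB pB => [|w t] uI yh yl nB pB; first by rewrite last_cat /= eqxx in yl.
exists s, u, w, t; split; rewrite ?cat_rcons ?next_cons2 //.
- by rewrite -cat_rcons next_cons2.
rewrite cat_rcons in uI *.
by rewrite -[RHS](prev_next uI) next_cons2.
Qed.

Lemma card_inner I B : uniq I -> size I <= #|inner I B| + 2 + 2 * #|B|.
Proof.
move=> uI; have <- : #|[set x in I]| = size I by rewrite cardsE (card_uniqP uI).
have sub : [set x in I] \subset
    inner I B :|: ([set head x0 I; last x0 I] :|: ((prev I @: B) :|: (next I @: B))).
  apply/subsetP=> y; rewrite !inE => yI; rewrite yI /=.
  case: (y == _) => //=; case: (y == _) => //=; rewrite ?orbT //.
  have [nB|nB] /= := boolP (next I y \in B).
    by apply/orP; left; apply/imsetP; exists (next I y); rewrite ?prev_next.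
  have [pB|pB] //= := boolP (prev I y \in B).
  by apply/orP; right; apply/imsetP; exists (prev I y); rewrite ?next_prev.
have := subset_leq_card sub.
have := card_setU_le (inner I B) ([set head x0 I; last x0 I] :|: ((prev I @: B) :|: (next I @: B))).
have := card_setU_le [set head x0 I; last x0 I] ((prev I @: B) :|: (next I @: B)).
have := card_setU_le (prev I @: B) (next I @: B).
have := leq_imset_card (prev I) B; have := leq_imset_card (next I) B.
have := cards2 (head x0 I) (last x0 I); case: (_ != _) => /=; lia.
Qed.

(** By closure, a pivot adjacent to [S] is in [S] or next to it on [I], so there are at most [3 |S|]
    of them. This contradicts expansion unless they are more than [|T| / 64], whence
    [192 = 3 * 64]. *)
Lemma closure_large I B S : uniq I -> S != set0 ->
  {in S & inner I B, forall x y, e x y -> [|| y \in S, next I y \in S | prev I y \in S]} ->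
  {in S, forall x, k <= 32 * deg_in (inner I B) x} -> #|T| <= 192 * #|S|.
Proof.
move=> uI S0 cl dS; set J := inner I B in cl dS.
pose A := [set y in J | [exists x in S, e x y]].
have cA : #|A| <= 3 * #|S|.
  have sub : A \subset S :|: ((prev I @: S) :|: (next I @: S)).
    apply/subsetP=> y; rewrite inE => /andP[yJ /existsP[x /andP[xS exy]]].
    rewrite !in_setU; case/or3P: (cl x y xS yJ exy) => [->//|h|h].
      apply/or3P/Or32/imsetP; exists (next I y) => //; by rewrite prev_next.
    apply/or3P/Or33/imsetP; exists (prev I y) => //; by rewrite next_prev.
  have := subset_leq_card sub.
  have := card_setU_le S ((prev I @: S) :|: (next I @: S)).
  have := card_setU_le (prev I @: S) (next I @: S).
  have := leq_imset_card (prev I) S; have := leq_imset_card (next I) S; lia.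
have S1 : 0 < #|S| by rewrite card_gt0.
have [leA|] := leqP (2 * 32 * #|A|) #|T|; last by lia.
have := mixu (c := 32) (S := S) (A := A); rewrite leA => /(_ _ isT) H.
have : q * #|S| <= 4 * 32 ^ 2 * #|A|; last by nia.
apply: H => x xS; apply: leq_trans (dS x xS) _; rewrite leq_mul2l /=.
apply: subset_leq_card; apply/subsetP=> y; rewrite !inE => /andP[yJ exy].
by rewrite yJ exy andbT /=; apply/existsP; exists x; rewrite xS.
Qed.

(* Vertices with few neighbours in [inner I B] are added to [B] one at a time;
   [mixing_lower] keeps [B] small, hence [inner I B] large, throughout. *)
Lemma bad_set I : uniq I -> #|T| + 80 + 2 * 1024 * #|T| %/ q <= 16 * size I ->
  exists B, q * #|B| <= 64 * #|T| /\ {in ~: B, forall x, k <= 32 * deg_in (inner I B) x}.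
Proof.
move=> uI lI.
pose P B := [forall x in B, 32 * deg_in (inner I B) x < k] && (q * #|B| <= 64 * #|T|).
have P0 : P set0 by rewrite /P cards0 muln0 andbT; apply/forall_inP=> x; rewrite inE.
case: (@maxset_exists _ P set0 P0) => B /maxsetP[/andP[/forall_inP lB cB] mB] _.
exists B; split=> // x; rewrite inE => xB; rewrite leqNgt; apply/negP=> ltx.
have : x |: B = B; last by move=> E; rewrite -E setU11 in xB.
apply: mB; last exact: subsetUr.
have lxB : {in x |: B, forall y, 32 * deg_in (inner I (x |: B)) y < k}.
  have mono y : deg_in (inner I (x |: B)) y <= deg_in (inner I B) y.
    apply: subset_leq_card; apply/subsetP=> z; rewrite !inE !negb_or.
    by case/andP=> /and5P[-> -> -> /andP[_ ->] /andP[_ ->]] ->.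
  move=> y /setU1P[->|yB]; [move: ltx|move: (lB y yB)]; have := mono x; have := mono y; lia.
apply/andP; split; first exact/forall_inP.
(* A block has at least about a twelfth of the vertices, so its inner part keeps density [1 / 16];
   the threshold [k / 32] is half of the corresponding mean. *)
apply: (mixl (c := 16) lxB).
have := card_inner (x |: B) uI; rewrite cardsU1 xB.
have : #|B| <= 64 * #|T| %/ q by rewrite leq_divRL; lia.
move: lI; have -> : 2 * 1024 * #|T| = 32 * (64 * #|T|) by lia.
have : 32 * (64 * #|T| %/ q) <= 32 * (64 * #|T|) %/ q.
  rewrite leq_divRL; last by lia.
  by rewrite -mulnA leq_mul2l /= leq_trunc_div.
lia.
Qed.

Lemma half_closure I B L : uniq I -> L != [::] -> uniq L -> sorted e L ->
  intact I L -> {in ~: B, forall x, k <= 32 * deg_in (inner I B) x} ->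
  last x0 L \notin B ->
  exists S, #|T| <= 192 * #|S| /\ {in S, forall x, exists L',
    [/\ perm_eq L' L, sorted e L', head x0 L' = head x0 L & last x0 L' = x]}.
Proof.
move=> uI L0 uL sL iI hB lB.
have [|S [bS sS hS cS]] := rotation_closure (Core := ~: B)
  (Int := inner I B) (f := next I) (g := prev I) x0 esym L0 uL sL.
  move=> y /(innerP uI)[i1 i2 n12 c1 c2]; split=> //.
    by move: iI; case/orP: i1 => h /(intact_trans h) //; rewrite /intact orbC.
  by move: iI; case/orP: i2 => h /(intact_trans h) //; rewrite /intact orbC.
exists S; split=> //; apply: closure_large cS _ => //.
  by apply/set0Pn; exists (last x0 L).
move=> x xS; apply: hB; move/subsetP: sS => /(_ x xS); rewrite in_setU1.
by case/predU1P=> // ->; rewrite inE.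
Qed.

(** All neighbours of the ends reached by rotations lie on [p], so a vertex off [p] has no neighbour
    in a set of linear size, and [mixing_lower] makes such vertices few. *)
Lemma longest_path_long p : 4 <= k -> longest_path e p -> p != [::] -> #|T| <= 2 * size p.
Proof.
move=> k4 lp p0; case: (lp) => up sp _.
have [|S [bS sS hS cS]] := rotation_closure (Core := ~: set0)
  (Int := inner p set0) (f := next p) (g := prev p) x0 esym p0 up sp.
  by move=> y /(innerP up).
have nS x y : x \in S -> e x y -> y \in p.
  move=> /hS[L [pL sL _ lL]] exy; rewrite -(perm_mem pL).
  apply: (longest_path_last (x0 := x0) (longest_path_perm lp pL sL)).
    by rewrite -size_eq0 (perm_size pL) size_eq0.
  by rewrite lL.
have lS : #|T| <= 192 * #|S|.
  apply: closure_large cS _ => //; first by apply/set0Pn; exists (last x0 p).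
  (* With [B] empty only the two ends of [p] are lost, which [4 <= k] absorbs. *)
  move=> x xS; have : k <= deg_in (inner p set0) x + 2; last by lia.
  rewrite -(deg x); have := cards2 (head x0 p) (last x0 p) => c2.
  have sub : [set y | e x y] \subset
      [set y in inner p set0 | e x y] :|: [set head x0 p; last x0 p].
    apply/subsetP=> y; rewrite !inE => exy; rewrite exy (nS x y) //= !andbT.
    by case: (y == _) => //=; case: (y == _).
  have := subset_leq_card sub.
  have := card_setU_le [set y in inner p set0 | e x y] [set head x0 p; last x0 p].
  rewrite /deg_in; move: c2; case: (_ != _) => /=; lia.
have := mixl (c := 192) (S := ~: [set x in p]) (A := S); rewrite lS => /(_ _ isT) H.
have : q * #|~: [set x in p]| <= 4 * 192 * #|T|.
  apply: H => x; rewrite !inE => xp; rewrite /deg_in.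
  suff -> : [set y in S | e x y] = set0 by rewrite cards0; lia.
  apply/setP=> y; rewrite !inE; apply/negP=> /andP[yS]; rewrite esym => /(nS _ _ yS).
  exact/negP.
have := cardsC [set x in p]; rewrite cardsE (card_uniqP up); nia.
Qed.
End PseudoRandom.

(** * Blocks of a path that no pivot meets *)

Section Block.
Variable T : eqType.
Implicit Types (p : seq T).

Definition block p (n j : nat) := take n (drop (j * n) p).

Lemma block_infix p n j : infix (block p n j) p.
Proof. apply: infix_trans (infix_take _ _) (infix_drop _ _). Qed.

Lemma size_block p n j : j.+1 * n <= size p -> size (block p n j) = n.
Proof. by move=> h; rewrite size_takel // size_drop; lia. Qed.

Lemma index_block p n j y : uniq p -> y \in block p n j -> index y p %/ n = j.
Proof.
move=> up yb; have := yb; rewrite /block -index_mem; set i := index y _.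
have -> : y = nth y p (j * n + i).
  rewrite -nth_drop -(nth_take _ (n0 := n)) ?nth_index //.
  by move: yb; rewrite -index_mem size_take -/i; case: ifP; lia.
rewrite size_take size_drop => lti.
have ltn : i < n by move: lti; case: ifP; lia.
rewrite index_uniq //; last by move: lti; case: ifP; lia.
by rewrite divnMDl ?divn_small ?addn0 //; lia.
Qed.

(** Two rotations at each end use four pivots, which meet at most four blocks; this is why there are
    six. *)
Lemma two_free_blocks p n (piv : seq T) : uniq p -> size piv <= 4 ->
  exists i j : 'I_6, [/\ i != j, {in piv, forall y, y \notin block p n i} &
                         {in piv, forall y, y \notin block p n j}].
Proof.
move=> up spiv; pose f y := index y p %/ n.
pose A := [set i : 'I_6 | (i : nat) \notin map f piv].
have free i : i \in A -> {in piv, forall y, y \notin block p n i}.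
  rewrite inE => iA y yp; apply: contra iA => /(index_block up) <-; exact: map_f.
have : 1 < #|A|.
  have cA := cardsC A; rewrite card_ord in cA.
  suff : #|~: A| <= 4 by lia.
  apply: leq_trans spiv; rewrite -(size_map f piv) cardE -(size_map (@nat_of_ord 6) (enum _)).
  apply: uniq_leq_size; first by rewrite map_inj_uniq ?enum_uniq //; apply: val_inj.
  by move=> _ /mapP[i iA ->]; move: iA; rewrite mem_enum !inE negbK.
case/card_gt1P=> i [j [iA jA nij]]; exists i, j; split=> //; exact: free.
Qed.
End Block.

(* At most four rotations make both ends of a longest path typical with respect to
   six blocks of it, and two of the blocks survive. Cutting between these, the two
   halves are rotated independently, so any edge between their sets of endpoints
   closes the path into a cycle. *)
Theorem hamiltonian_of_mixing (T : finType) (e : rel T) (k q : nat) :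
  symmetric e -> irreflexive e -> connected_graph e ->
  (forall x, #|[set y | e x y]| = k) ->
  mixing_lower e k q -> mixing_upper e k q ->
  200 * 1000 <= q -> 4 <= k -> 4 * k <= #|T| -> 1000 <= #|T| ->
  8 * 1000 * #|T| <= k * q ^ 2 -> hamiltonian e.
Proof.
move=> esym eirr conn deg mixl mixu ql k4 lekT T1000 lekq.
have [x0 _] : exists x : T, x \in T by apply/card_gt0P; apply: leq_trans T1000.
have [p lp p0] := longest_path_exists e x0; case: (lp) => up sp _.
have szp : #|T| <= 2 * size p by apply: (longest_path_long x0 esym deg mixl mixu).
set n := size p %/ 6.
have n6 : 6 * n <= size p < 6 * n + 6 by rewrite /n; lia.
have n0 : 0 < n.
  by move: szp T1000 n6; clear; move: #|T| (size p) n => t s n'; lia.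
have szb (j : 'I_6) : size (block p n j) = n.
  rewrite size_block //; apply: (@leq_trans (6 * n)); last by case/andP: n6.
  by rewrite leq_mul2r ltn_ord orbT.
have ub j : uniq (block p n j) by apply: infix_uniq (block_infix _ _ _) up.
have bad (j : 'I_6) : exists B : {set T}, q * #|B| <= 64 * #|T| /\
    {in ~: B, forall x, k <= 32 * deg_in e (inner x0 (block p n j) B) x}.
  apply: bad_set => //; rewrite szb.
  have h : 2 * 1024 * #|T| %/ q * q <= 2 * 1024 * #|T| by apply: leq_trunc_div.
  have : 8 * (2 * 1024 * #|T| %/ q) <= #|T| by nia.
  lia.
have [Bad hBad] := fin_all_exists bad.
pose B := \bigcup_(j < 6) Bad j.
have cB : q * #|B| <= 384 * #|T|.
  have : #|B| <= \sum_(j < 6) #|Bad j|.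
    rewrite /B; elim/big_ind2: _ => [|A1 n1 A2 n2 h1 h2|//]; first by rewrite cards0.
    exact: leq_trans (card_setU_le _ _) (leq_add h1 h2).
  move=> h; apply: (@leq_trans (q * \sum_(j < 6) #|Bad j|)).
    by rewrite leq_mul2l h orbT.
  have : \sum_(j < 6) (q * #|Bad j|) <= \sum_(j < 6) (64 * #|T|).
    by apply: leq_sum => j _; case: (hBad j).
  rewrite sum_nat_const card_ord big_distrr /=; lia.
have BadP x j : x \notin B -> x \notin Bad j.
  by apply: contra => h; apply/bigcupP; exists j.
(* In the next line, [8 * 1000 * |T| <= k * q ^ 2] bounds [8 |B|] by less than [q k / 2]. *)
have ltB1 : 2 * (2 * #|B| + k) < #|T| by nia.
have ltB2 : 4 * (2 * #|B| + k) < q * k by nia.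
have expand (S S' : {set T}) : {in S, forall x y, e x y -> y \in S'} ->
     2 * #|S'| <= #|T| -> q * #|S| <= 4 * #|S'|.
  move=> h c; have := mixu 1 S S'; rewrite exp1n !muln1; apply => // x xS.
  rewrite mul1n -(deg x); apply: subset_leq_card; apply/subsetP=> y; rewrite !inE => exy.
  by rewrite exy (h x).
have [p1 [piv1 [s1 pp1 sp1 [h1 l1] i1]]] := two_rotations x0 esym eirr lp p0 deg expand ltB1 ltB2.
have lp1 := longest_path_rev esym (longest_path_perm lp pp1 sp1).
have r0 : rev p1 != [::] by rewrite -size_eq0 size_rev (perm_size pp1) size_eq0.
have [p2 [piv2 [s2 pp2 sp2 [h2 l2] i2]]] := two_rotations x0 esym eirr lp1 r0 deg expand ltB1 ltB2.
rewrite head_rev in h2; set r := rev p2.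
have lr : last x0 r \notin B by rewrite last_rev h2.
have hr : head x0 r \notin B by rewrite head_rev.
have ppr : perm_eq r p.
  by rewrite perm_rev (perm_trans pp2) // perm_rev.
have spr : sorted e r by rewrite sorted_rev.
have ur : uniq r by rewrite (perm_uniq ppr).
have ir I : {in piv1 ++ piv2, forall y, y \notin I} -> intact I p -> intact I r.
  move=> h ip; rewrite intact_rev; apply: i2.
    by move=> y yp; apply: h; rewrite mem_cat yp orbT.
  by rewrite intact_rev; apply: i1 => // y yp; apply: h; rewrite mem_cat yp.
have [|i [j [nij fi fj]]] := two_free_blocks n (piv := piv1 ++ piv2) up.
  by rewrite size_cat s1 s2.
have bn0 (l : 'I_6) : block p n l != [::] by rewrite -size_eq0 szb -lt0n.
have bI (l : 'I_6) : intact (block p n l) p by rewrite /intact block_infix.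
have [|r1 [r2 [rE hr12]]] := intact_split (bn0 i) (bn0 j) _
  (ir _ fi (bI i)) (ir _ fj (bI j)).
  move=> x xi; apply: contra nij => xj; rewrite -val_eqE /=.
  by rewrite -(index_block up xi) (index_block up xj).
have {i j nij fi fj hr12} [i [j [ii ij]]] : exists i j : 'I_6,
    intact (block p n i) r1 /\ intact (block p n j) r2.
  by case: hr12 => -[]; [exists i, j|exists j, i].
have r10 : r1 != [::].
  by case: (r1) ii => //; case: (block p n i) (bn0 i) => // y b _ /intact_mem/(_ (mem_head _ _)).
have r20 : r2 != [::].
  by case: (r2) ij => //; case: (block p n j) (bn0 j) => // y b _ /intact_mem/(_ (mem_head _ _)).
have rr10 : rev r1 != [::] by rewrite -size_eq0 size_rev size_eq0.
move: ur spr; rewrite rE cat_uniq (sorted_catE e x0) // => /and3P[ur1 _ ur2] /and3P[sr1 er sr2].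
have hr1 : head x0 r1 \notin B by move: hr; rewrite rE; case: (r1) r10.
have lr2 : last x0 r2 \notin B by move: lr; rewrite rE last_cat; case: (r2) r20.
have urr1 : uniq (rev r1) by rewrite rev_uniq.
have srr1 : sorted e (rev r1) by rewrite sorted_rev.
have irr1 : intact (block p n i) (rev r1) by rewrite intact_rev.
have lrr1 : last x0 (rev r1) \notin Bad i by rewrite last_rev; apply: BadP.
(* Reversing [r1] puts its cut end at the head, which rotations fix, so the edge across the cut
   survives on both sides. *)
have [S1 [cS1 hS1]] :=
  half_closure esym mixu ql (ub i) rr10 urr1 srr1 irr1 (hBad i).2 lrr1.
have [S2 [cS2 hS2]] :=
  half_closure esym mixu ql (ub j) r20 ur2 sr2 ij (hBad j).2 (BadP _ j lr2).
have [x [y [xS yS exy]]] : exists x y, [/\ x \in S1, y \in S2 & e x y].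
  have [/existsP[x /andP[xS /existsP[y /andP[yS exy]]]]|nex] :=
      boolP [exists x in S1, exists y in S2, e x y]; first by exists x, y.
  (* Without such an edge, sets of size at least [|T| / 192] would force
     [q <= 4 * 192 ^ 2 = 147456]; the bound [200 * 1000] on [q] exceeds this. *)
  have : q * #|S1| <= 4 * 192 * #|T|;
    last by move: ql cS1 T1000; clear; move: #|T| #|S1| => t s; nia.
  apply: (mixl 192 S1 S2) => // x xS; rewrite /deg_in.
  suff -> : [set y in S2 | e x y] = set0 by rewrite cards0 muln0 (leq_trans _ k4).
  apply/setP=> y; rewrite !inE; apply: contraNF nex => /andP[yS exy].
  by apply/existsP; exists x; rewrite xS; apply/existsP; exists y; rewrite yS.
have [L1 [pL1 sL1 hL1 lL1]] := hS1 x xS; have [L2 [pL2 sL2 hL2 lL2]] := hS2 y yS.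
have L10 : L1 != [::] by rewrite -size_eq0 (perm_size pL1) size_eq0.
have L20 : L2 != [::] by rewrite -size_eq0 (perm_size pL2) size_eq0.
have rL10 : rev L1 != [::] by rewrite -size_eq0 size_rev size_eq0.
have pc : perm_eq (rev L1 ++ L2) p.
  apply: perm_trans ppr; rewrite rE; apply: perm_cat pL2.
  by rewrite perm_rev (perm_trans pL1) // perm_rev.
have c0 : rev L1 ++ L2 != [::] by rewrite -size_eq0 (perm_size pc) size_eq0.
have cyc : cycle e (rev L1 ++ L2).
  have sc : sorted e (rev L1 ++ L2).
    rewrite (sorted_catE e x0) // sorted_rev // sL1 sL2 last_rev hL1 head_rev hL2.
    by rewrite er.
  have hc : head x0 (rev L1 ++ L2) = x by case: (rev L1) rL10 (head_rev x0 L1) => //= z s _ ->.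
  have lc : last x0 (rev L1 ++ L2) = y by rewrite last_cat; case: (L2) L20 lL2.
  by case: (rev L1 ++ L2) c0 sc hc lc => //= z s _ ps zx ly; rewrite rcons_path ps ly zx esym.
have call := longest_path_cycle esym conn lp pc c0 cyc.
exists (rev L1 ++ L2); split=> //; first by rewrite (perm_uniq pc).
by rewrite (perm_size pc); move: szp T1000; clear; move: #|T| (size p) => t s; lia.
Qed.

(** * Eigenvalue bounds *)

Local Open Scope ring_scope.

Lemma sqr_sum_le (R : realFieldType) (I : finType) (P : pred I) (u : I -> R) :
  (\sum_(i | P i) u i) ^+ 2 <= #|P|%:R * \sum_(i | P i) u i ^+ 2.
Proof.
set U := \sum_(i | P i) u i; set N := \sum_(i | P i) _; set t := #|P|%:R.
have [P0|Pn0] := eqVneq #|P| 0%N.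
  by rewrite /U big_pred0 ?expr0n ?mulr_ge0 ?sumr_ge0 // => [i _|]; [exact: sqr_ge0|exact/card0_eq].
have t0 : 0 < t by rewrite ltr0n lt0n.
have : 0 <= \sum_(i | P i) (t * u i - U) ^+ 2 by apply: sumr_ge0 => i _; exact: sqr_ge0.
have -> : \sum_(i | P i) (t * u i - U) ^+ 2 = t ^+ 2 * N - 2 * t * U * U + t * U ^+ 2.
  rewrite (eq_bigr (fun i => t ^+ 2 * u i ^+ 2 - 2 * t * U * u i + U ^+ 2));
    last by move=> i _; ring.
  rewrite big_split sumrB /= -!mulr_sumr sumr_const -[_ *+ #|P|]mulr_natl -/t -/U -/N.
  ring.
have -> : t ^+ 2 * N - 2 * t * U * U + t * U ^+ 2 = t * (t * N - U ^+ 2) by ring.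
by rewrite pmulr_rge0 // subr_ge0.
Qed.

(** In a full-rank factorisation [E = C R] of an idempotent, [R C = 1]; cyclicity of the trace
    concludes. *)
Lemma idempotent_trace (F : fieldType) (n : nat) (E : 'M[F]_n) : E *m E = E -> \tr E = (\rank E)%:R.
Proof.
move=> EE; have E2 := mulmx_base E.
have : row_base E *m col_base E = 1%:M.
  have := EE; rewrite -{1 2 3}E2 => h.
  have fr := row_base_free E; have fc := col_base_full E.
  have h1 : col_base E *m (row_base E *m col_base E) *m row_base E =
      col_base E *m 1%:M *m row_base E.
    by rewrite mulmx1 !mulmxA in h *.
  exact: (row_full_inj fc (row_free_inj fr h1)).
by move=> h; rewrite -{1}E2 mxtrace_mulC h mxtrace1.
Qed.

Section Spectral.
Variables (R : realFieldType) (T : finType) (a : T -> T -> R) (k r m mu : R).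
Hypothesis a_sym : forall x y, a x y = a y x.
Hypothesis a_row : forall x, \sum_y a x y = k.
Hypothesis a_sq : forall x y,
  \sum_z a x z * a z y = r * m * (x == y)%:R + (r - m) * a x y + mu.
Hypotheses (r_ge0 : 0 <= r) (m_gt0 : 0 < m) (T_gt0 : (0 < #|T|)%N).

Notation v := (#|T|%:R : R).
Notation act f := (fun x => \sum_y a x y * f y).
Notation nrm f := (\sum_x f x ^+ 2).
Notation quad f := (\sum_x f x * \sum_y a x y * f y).

Let v_gt0 : 0 < v. Proof. by rewrite ltr0n. Qed.
Let v_neq0 : v != 0. Proof. exact: lt0r_neq0. Qed.

Lemma sum_delta (f : T -> R) x : \sum_y (x == y)%:R * f y = f x.
Proof.
rewrite (bigD1 x) //= eqxx mul1r big1 ?addr0 // => y; rewrite eq_sym => /negPf->.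
by rewrite mul0r.
Qed.

Lemma feasibility : mu * v = (k - r) * (k + m).
Proof.
have [x _] : exists x, x \in T by apply/card_gt0P.
have : \sum_y \sum_z a x z * a z y = k * k.
  rewrite exchange_big /=; under eq_bigr => z _ do rewrite -mulr_sumr a_row.
  by rewrite -mulr_suml a_row.
under eq_bigr => y _ do rewrite a_sq.
rewrite !big_split /= -!mulr_sumr a_row sumr_const cardT -cardE -[mu *+ _]mulr_natr.
have -> : \sum_y (x == y)%:R = 1 :> R.
  by have := sum_delta (fun=> 1) x; under eq_bigr do rewrite mulr1.
move=> h; have -> : mu * v = k * k - r * m * 1 - (r - m) * k by rewrite -h; ring.
by ring.
Qed.

Lemma sum_act (f : T -> R) : \sum_x act f x = k * \sum_x f x.
Proof.
rewrite exchange_big /= mulr_sumr; apply: eq_bigr => y _.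
by rewrite -mulr_suml; under eq_bigr => x _ do rewrite a_sym; rewrite a_row.
Qed.

Lemma nrm_act (f : T -> R) :
  nrm (act f) = r * m * nrm f + (r - m) * quad f + mu * (\sum_x f x) ^+ 2.
Proof.
have -> : nrm (act f) = \sum_y f y * \sum_z f z * \sum_x a y x * a x z.
  transitivity (\sum_x \sum_y \sum_z f y * (f z * (a y x * a x z))).
    apply: eq_bigr => x _; rewrite expr2 big_distrl /=; apply: eq_bigr => y _.
    rewrite big_distrr /=; apply: eq_bigr => z _; rewrite [a y x]a_sym; ring.
  rewrite exchange_big /=; apply: eq_bigr => y _.
  rewrite exchange_big /= mulr_sumr; apply: eq_bigr => z _.
  by rewrite !mulr_sumr.
transitivity (\sum_y (r * m * f y ^+ 2 + (r - m) * (f y * \sum_z a y z * f z)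
   + mu * (f y * \sum_z f z))); last first.
  by rewrite !big_split /= -!mulr_sumr -mulr_suml expr2.
apply: eq_bigr => y _.
have -> : \sum_z f z * \sum_x a y x * a x z =
    r * m * f y + (r - m) * (\sum_z a y z * f z) + mu * \sum_z f z.
  rewrite (eq_bigr (fun z => r * m * ((y == z)%:R * f z) + (r - m) * (a y z * f z)
    + mu * f z)); last by move=> z _; rewrite a_sq; ring.
  by rewrite !big_split /= -!mulr_sumr sum_delta.
ring.
Qed.

(** The matrix [P = r I - A + c J] satisfies [P^2 = (r + m) P], so the squared norm of [P f] is
    [r + m] times the quadratic form of [P] at [f], which is therefore nonnegative. The lower bound
    uses [m I + A - c J] in the same way. *)
Lemma quad_le (f : T -> R) :
  v * quad f <= r * v * nrm f + (k - r) * (\sum_x f x) ^+ 2.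
Proof.
set s := \sum_x f x; pose c := (k - r) / v.
have : 0 <= \sum_x (r * f x - act f x + c * s) ^+ 2.
  by apply: sumr_ge0 => x _; apply: sqr_ge0.
have -> : \sum_x (r * f x - act f x + c * s) ^+ 2 =
    r ^+ 2 * nrm f - 2 * r * quad f + nrm (act f) + 2 * r * c * s * s
    - 2 * c * s * (k * s) + v * (c * s) ^+ 2.
  rewrite (eq_bigr (fun x => r ^+ 2 * f x ^+ 2 - 2 * r * (f x * act f x)
    + act f x ^+ 2 + 2 * r * c * s * f x - 2 * c * s * act f x + (c * s) ^+ 2));
    last by move=> x _; ring.
  rewrite !(big_split, sumrN) /= -!mulr_sumr sum_act sumr_const cardT -cardE.
  rewrite -/s -[s *+ _]mulr_natl; ring.
rewrite nrm_act -/s => h.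
have cE : c * v = k - r by rewrite /c divfK.
have muE : mu = c * (k + m).
  by apply: (mulIf v_neq0); rewrite feasibility -cE; ring.
have rm : 0 < r + m by apply: ltr_wpDl.
have : 0 <= (r + m) * (r * nrm f - quad f + c * s ^+ 2).
  apply: le_trans h _; rewrite le_eqVlt; apply/orP; left; apply/eqP.
  have -> : v * (c * s) ^+ 2 = c * (k - r) * s ^+ 2 by rewrite -cE; ring.
  by rewrite muE; ring.
rewrite pmulr_rge0 // => h2.
have : 0 <= v * (r * nrm f - quad f + c * s ^+ 2) by rewrite mulr_ge0 // ltW.
by rewrite -cE; lra.
Qed.

Lemma quad_ge (f : T -> R) :
  (k + m) * (\sum_x f x) ^+ 2 <= v * quad f + m * v * nrm f.
Proof.
set s := \sum_x f x; pose c := (k + m) / v.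
have : 0 <= \sum_x (m * f x + act f x - c * s) ^+ 2.
  by apply: sumr_ge0 => x _; apply: sqr_ge0.
have -> : \sum_x (m * f x + act f x - c * s) ^+ 2 =
    m ^+ 2 * nrm f + 2 * m * quad f + nrm (act f) - 2 * m * c * s * s
    - 2 * c * s * (k * s) + v * (c * s) ^+ 2.
  rewrite (eq_bigr (fun x => m ^+ 2 * f x ^+ 2 + 2 * m * (f x * act f x)
    + act f x ^+ 2 - 2 * m * c * s * f x - 2 * c * s * act f x + (c * s) ^+ 2));
    last by move=> x _; ring.
  rewrite !(big_split, sumrN) /= -!mulr_sumr sum_act sumr_const cardT -cardE.
  rewrite -/s -[s *+ _]mulr_natl; ring.
rewrite nrm_act -/s => h.
have cE : c * v = k + m by rewrite /c divfK.
have muE : mu = c * (k - r).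
  by apply: (mulIf v_neq0); rewrite feasibility -cE; ring.
have rm : 0 < r + m by apply: ltr_wpDl.
have : 0 <= (r + m) * (m * nrm f + quad f - c * s ^+ 2).
  apply: le_trans h _; rewrite le_eqVlt; apply/orP; left; apply/eqP.
  have -> : v * (c * s) ^+ 2 = c * (k + m) * s ^+ 2 by rewrite -cE; ring.
  by rewrite muE; ring.
rewrite pmulr_rge0 // => h2.
have : 0 <= v * (m * nrm f + quad f - c * s ^+ 2) by rewrite mulr_ge0 // ltW.
by rewrite -cE; lra.
Qed.

(** This bounds the operator norm of [A - (k / v) J]. The squared norm of [A f] contains the
    quadratic form with coefficient [r - m], whose sign decides which of [quad_le] and [quad_ge]
    applies. *)
Lemma variance_le (f : T -> R) (M : R) : r <= M -> m <= M ->
  \sum_x (v * act f x - k * \sum_y f y) ^+ 2 <= v ^+ 2 * M ^+ 2 * nrm f.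
Proof.
move=> rM mM; have ql := quad_le f; have qg := quad_ge f.
have := nrm_act f; move: ql qg; set s := \sum_y f y; set F := nrm f; set Q := quad f.
set N := nrm (act f) => ql qg NE.
have -> : \sum_x (v * act f x - k * s) ^+ 2 = v * (v * N - k ^+ 2 * s ^+ 2).
  rewrite (eq_bigr (fun x => v ^+ 2 * act f x ^+ 2 - 2 * v * k * s * act f x
    + (k * s) ^+ 2)); last by move=> x _; ring.
  rewrite !(big_split, sumrN) /= -!mulr_sumr sum_act sumr_const cardT -cardE.
  rewrite -/s -/N -[s *+ _]mulr_natl; ring.
have F0 : 0 <= F by apply: sumr_ge0 => x _; apply: sqr_ge0.
have s0 : 0 <= s ^+ 2 by apply: sqr_ge0.
have -> : v ^+ 2 * M ^+ 2 * F = v * (v * M ^+ 2 * F) by ring.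
rewrite ler_pM2l // NE.
have -> : v * (r * m * F + (r - m) * Q + mu * s ^+ 2) - k ^+ 2 * s ^+ 2 =
   v * r * m * F + (r - m) * (v * Q) + (mu * v - k ^+ 2) * s ^+ 2 by ring.
rewrite feasibility.
have vF : 0 <= v * F by rewrite mulr_ge0 // ltW.
have [rm|mr] := leP m r.
  apply: (@le_trans _ _ (r ^+ 2 * (v * F) - r ^+ 2 * s ^+ 2)).
    have : (r - m) * (v * Q) <= (r - m) * (r * v * F + (k - r) * s ^+ 2).
      by rewrite ler_wpM2l // subr_ge0.
    lra.
  apply: (@le_trans _ _ (r ^+ 2 * (v * F))).
    by rewrite gerBl mulr_ge0 // sqr_ge0.
  rewrite [leRHS](_ : _ = M ^+ 2 * (v * F)); last by ring.
  by rewrite ler_wpM2r // lerXn2r ?nnegrE ?(le_trans r_ge0 rM) ?(ltW m_gt0).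
apply: (@le_trans _ _ (m ^+ 2 * (v * F) - m ^+ 2 * s ^+ 2)).
  have : (m - r) * ((k + m) * s ^+ 2 - m * v * F) <= (m - r) * (v * Q).
    rewrite ler_wpM2l //; first by rewrite subr_ge0 ltW.
    lra.
  lra.
apply: (@le_trans _ _ (m ^+ 2 * (v * F))).
  by rewrite gerBl mulr_ge0 // sqr_ge0.
rewrite [leRHS](_ : _ = M ^+ 2 * (v * F)); last by ring.
by rewrite ler_wpM2r // lerXn2r ?nnegrE ?(le_trans r_ge0 rM) ?(ltW m_gt0).
Qed.

(* A multiple of the orthogonal projection onto the eigenspace of [- m]. *)
Definition proj x y : R := r * (x == y)%:R - a x y + (k - r) / v.

Lemma proj_sym x y : proj x y = proj y x.
Proof. by rewrite /proj eq_sym a_sym. Qed.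

Lemma proj_sq x y : \sum_z proj x z * proj z y = (r + m) * proj x y.
Proof.
rewrite /proj; set c := (k - r) / v.
have cE : c * v = k - r by rewrite /c divfK.
have muE : mu = c * (k + m).
  by apply: (mulIf v_neq0); rewrite feasibility -cE; ring.
rewrite (eq_bigr (fun z => r * (r * ((x == z)%:R * (z == y)%:R)) - r * ((x == z)%:R * a z y)
  + r * c * ((x == z)%:R * 1) - r * ((y == z)%:R * a x z) + a x z * a z y - c * a x z
  + r * c * ((y == z)%:R * 1) - c * a y z + c * c)); last first.
  by move=> z _; rewrite (eq_sym y z) (a_sym y z); ring.
rewrite !(big_split, sumrN) /= -!mulr_sumr !sum_delta !a_row a_sq sumr_const cardT -cardE.
by rewrite -[v^-1 *+ _]mulr_natr mulVf // muE mulr1; ring.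
Qed.

(* [proj] is positive semidefinite, and the matrix of cubes is a principal submatrix
   of its tensor cube. *)
Lemma sum_proj_cube_ge0 : 0 <= \sum_x \sum_y proj x y ^+ 3.
Proof.
have rm : 0 < r + m by apply: ltr_wpDl.
rewrite -(pmulr_rge0 _ (exprn_gt0 3 rm)).
have -> : (r + m) ^+ 3 * \sum_x \sum_y proj x y ^+ 3 =
    \sum_z1 \sum_z2 \sum_z3 (\sum_x proj x z1 * proj x z2 * proj x z3) ^+ 2.
  transitivity (\sum_x \sum_y \sum_z1 \sum_z2 \sum_z3
    (proj x z1 * proj x z2 * proj x z3) * (proj y z1 * proj y z2 * proj y z3)).
    rewrite mulr_sumr; apply: eq_bigr => x _; rewrite mulr_sumr; apply: eq_bigr => y _.
    rewrite -exprMn -proj_sq exprS expr2 big_distrl /=; apply: eq_bigr => z1 _.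
    rewrite big_distrl big_distrr /=; apply: eq_bigr => z2 _.
    rewrite !big_distrr /=; apply: eq_bigr => z3 _.
    by rewrite !(proj_sym _ y); ring.
  transitivity (\sum_z1 \sum_z2 \sum_z3 \sum_x \sum_y
    (proj x z1 * proj x z2 * proj x z3) * (proj y z1 * proj y z2 * proj y z3)).
    under eq_bigr => x _ do rewrite exchange_big.
    rewrite exchange_big /=; apply: eq_bigr => z1 _.
    under eq_bigr => x _ do rewrite exchange_big.
    rewrite exchange_big /=; apply: eq_bigr => z2 _.
    under eq_bigr => x _ do rewrite exchange_big.
    by rewrite exchange_big.
  do 3 (apply: eq_bigr => ? _); rewrite expr2 big_distrl /=; apply: eq_bigr => x _.
  by rewrite big_distrr.
do 3 (apply: sumr_ge0 => ? _); exact: sqr_ge0.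
Qed.

(** [proj] divided by [r + m] is idempotent, so its trace, read off the diagonal, equals its rank.
    This is the multiplicity of the eigenvalue [- m]. *)
Lemma multiplicity : (forall x, a x x = 0) ->
  exists g : nat, g%:R * (r + m) = v * r + k - r.
Proof.
move=> a0; have rm : 0 < r + m by apply: ltr_wpDl.
have rm0 : r + m != 0 by apply: lt0r_neq0.
pose E : 'M[R]_#|T| := \matrix_(i, j) (proj (enum_val i) (enum_val j) / (r + m)).
have EE : E *m E = E.
  apply/matrixP=> i j; rewrite !mxE.
  under eq_bigr => l _ do rewrite !mxE.
  rewrite -(big_enum_val (fun z =>
    proj (enum_val i) z / (r + m) * (proj z (enum_val j) / (r + m)))) /=.
  under eq_bigl => z do rewrite inE.
  rewrite (eq_bigr (fun z =>
    (proj (enum_val i) z * proj z (enum_val j)) / (r + m) ^+ 2)); last first.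
    by move=> z _; field.
  by rewrite -mulr_suml proj_sq; field.
exists (\rank E); rewrite -(idempotent_trace EE) /mxtrace.
under eq_bigr => i _ do rewrite mxE /proj eqxx a0 mulr1 subr0.
rewrite sumr_const card_ord -[_ *+ #|T|]mulr_natr; field.
by rewrite rm0 v_neq0.
Qed.
End Spectral.

(** * Strongly regular graphs *)

(** Here [a] is the size of one side, [d] its average inner degree and [t] the size of the
    separator. Using [t < K] and then [a >= d + 1], the two sides of the inequality differ by [K d
    ((r + 1) (M - 2) + (r - d)) + (d + 1) d^2], which is nonnegative for [M >= 2]. *)
Lemma separator_arith (R : realFieldType) (r K M a d t mu' : R) : 0 <= K -> 2 <= M -> 0 <= d <= r ->
  d + 1 <= a -> 0 < mu' -> K = mu' + r * M -> 0 <= t < K ->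
  a * (K - d) ^+ 2 <= t * ((r - d) * (d + M) + a * mu') -> False.
Proof.
move=> K0 M2 /andP[d0 dr] da mu0 KE /andP[t0 tK] h.
have r0 : 0 <= r by apply: le_trans d0 dr.
have X0 : 0 < (r - d) * (d + M) + a * mu'.
  apply: ltr_wpDl; first by rewrite mulr_ge0 //; lra.
  by rewrite mulr_gt0 //; lra.
have h1 : a * (K - d) ^+ 2 < K * ((r - d) * (d + M) + a * mu').
  by apply: le_lt_trans h _; rewrite ltr_pM2r.
have h2 : a * (K * r * M - 2 * K * d + d ^+ 2) < K * ((r - d) * (d + M)).
  have -> : K * r * M - 2 * K * d + d ^+ 2 = (K - d) ^+ 2 - K * mu'.
    rewrite [in RHS](_ : (K - d) ^+ 2 = K * K - 2 * K * d + d ^+ 2); last by ring.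
    rewrite {2}[in RHS]KE; ring.
  lra.
have rM : 0 <= r * M - 2 * d.
  have : 0 <= r * (M - 2) by rewrite mulr_ge0 //; lra.
  lra.
have p0 : 0 <= K * r * M - 2 * K * d + d ^+ 2.
  rewrite addr_ge0 ?sqr_ge0 //; have := mulr_ge0 K0 rM; lra.
have h3 : (d + 1) * (K * r * M - 2 * K * d + d ^+ 2) <= a * (K * r * M - 2 * K * d + d ^+ 2).
  by rewrite ler_wpM2r.
have h4 : 0 <= K * (d * ((r + 1) * (M - 2) + (r - d))).
  by rewrite !mulr_ge0 // addr_ge0 ?mulr_ge0 //; lra.
have h5 : 0 <= (d + 1) * d ^+ 2 by rewrite mulr_ge0 ?sqr_ge0 //; lra.
lra.
Qed.

Section StronglyRegular.
Variables (T : finType) (e : rel T) (k lam mu : nat).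
Hypothesis esrg : srg e #|T| k lam mu.

Let esym : symmetric e. Proof. by case: esrg => -[]. Qed.
Let eirr : irreflexive e. Proof. by case: esrg => -[]. Qed.
Let edeg x : #|[set y | e x y]| = k. Proof. by case: esrg => _ [_ []]. Qed.
Let elam x y : e x y -> #|[set z | e x z && e y z]| = lam.
Proof. by case: esrg => _ [_ [_ [h _]]]; apply: h. Qed.
Let emu x y : x != y -> ~~ e x y -> #|[set z | e x z && e y z]| = mu.
Proof. by case: esrg => _ [_ [_ [_ [h _]]]]; apply: h. Qed.
Let nonadj : exists x y : T, x != y /\ ~~ e x y.
Proof. by case: esrg => _ [_ [_ [_ [_ []]]]]. Qed.
Let adj : exists x y : T, e x y.
Proof. by case: esrg => _ [_ [_ [_ [_ []]]]]. Qed.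

Lemma srg_T_gt0 : (0 < #|T|)%N.
Proof. by case: adj => x _; apply/card_gt0P; exists x. Qed.

Lemma srg_k_lt : (k.+1 < #|T|)%N.
Proof.
case: nonadj => x [y [nxy exy]]; rewrite -(edeg x).
have : (#|[set y | e x y] :|: [set x; y]| <= #|T|)%N by apply: max_card.
rewrite cardsU cards2 nxy (_ : _ :&: _ = set0) ?cards0 ?subn0; first by lia.
apply/setP=> z; rewrite !inE; case: eqP => [->|_]; rewrite ?eirr //=.
by case: eqP => [->|_]; rewrite ?andbF // (negPf exy).
Qed.

Lemma srg_mu_le : (mu <= k)%N.
Proof.
case: nonadj => x [y [nxy exy]]; rewrite -(emu nxy exy) -(edeg x).
by apply: subset_leq_card; apply/subsetP=> z; rewrite !inE => /andP[].
Qed.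

(** If [mu = 0], adjacency is transitive between distinct vertices, and connectedness would make the
    graph complete. *)
Lemma srg_mu_gt0 : connected_graph e -> (0 < mu)%N.
Proof.
move=> conn; case: nonadj => x [y [nxy exy]]; rewrite lt0n; apply/eqP => mu0.
have step u z w : e u z -> e z w -> (u == w) || e u w.
  move=> euz ezw; case: eqVneq => //= nuw; apply: contraT => nuw'.
  have := emu nuw nuw'; rewrite mu0 => /eqP; rewrite cards_eq0 => /eqP/setP/(_ z).
  by rewrite !inE euz esym ezw.
case/connectP: (conn x y) => p; elim/last_ind: p y nxy exy => [|p y IH] y' nxy exy /=.
  by move=> _ E; rewrite E eqxx in nxy.
rewrite rcons_path last_rcons => /andP[pp ey] E; move: nxy exy; rewrite {y'}E => nxy exy.
have [E|nl] := eqVneq x (last x p); first by rewrite E ey in exy.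
have [exl|nexl] := boolP (e x (last x p)).
  by have := step _ _ _ exl ey; rewrite (negPf nxy) (negPf exy).
exact: (IH _ nl nexl pp erefl).
Qed.

Section Eigenvalues.
Variables (R : realFieldType) (r m : R).
Hypothesis rmE : r * m = k%:R - mu%:R.
Hypothesis rBm : r - m = lam%:R - mu%:R.
Hypotheses (r_ge0 : 0 <= r) (m_gt0 : 0 < m).

Definition adjm (x y : T) : R := (e x y)%:R.

Lemma adjm_sym x y : adjm x y = adjm y x.
Proof. by rewrite /adjm esym. Qed.

Lemma adjm_sum (S : {set T}) x : \sum_y adjm x y * (y \in S)%:R = (deg_in e S x)%:R.
Proof.
rewrite /deg_in -sum1_card natr_sum [RHS]big_mkcond /=; apply: eq_bigr => y _.
by rewrite !inE /adjm; case: (y \in S); case: (e x y); rewrite ?mulr1 ?mulr0.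
Qed.

Lemma deg_in_setT x : deg_in e setT x = k.
Proof. by rewrite -(edeg x); apply: eq_card => y; rewrite !inE. Qed.

Lemma adjm_row x : \sum_y adjm x y = k%:R.
Proof.
rewrite -(deg_in_setT x) -adjm_sum; apply: eq_bigr => y _.
by rewrite inE mulr1.
Qed.

Lemma adjm_sq x y :
  \sum_z adjm x z * adjm z y = r * m * (x == y)%:R + (r - m) * adjm x y + mu%:R.
Proof.
have -> : \sum_z adjm x z * adjm z y = #|[set z | e x z && e y z]|%:R.
  rewrite -sum1_card natr_sum [RHS]big_mkcond /=; apply: eq_bigr => z _.
  rewrite inE /adjm (esym z y); by case: (e x z); case: (e y z); rewrite ?mulr1 ?mulr0.
rewrite rmE rBm; case: eqVneq => [<-|nxy].
  rewrite /adjm eirr (_ : [set z | _ & _] = [set z | e x z]) ?edeg.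
    by rewrite mulr1 mulr0 addr0 subrK.
  by apply/setP=> z; rewrite !inE andbb.
rewrite /adjm; have [exy|exy] := boolP (e x y); first by rewrite elam // mulr0 mulr1 add0r subrK.
by rewrite emu // !mulr0 !add0r.
Qed.

Lemma srg_feasibility : mu%:R * #|T|%:R = (k%:R - r) * (k%:R + m).
Proof. exact: (feasibility adjm_row adjm_sq srg_T_gt0). Qed.

Lemma sum_ind (S : {set T}) : \sum_x (x \in S)%:R = #|S|%:R :> R.
Proof. by rewrite -sum1_card natr_sum [RHS]big_mkcond; apply: eq_bigr => x _; case: ifP. Qed.

Lemma sum_ind_sq (S : {set T}) : \sum_x (x \in S)%:R ^+ 2 = #|S|%:R :> R.
Proof. by rewrite -sum_ind; apply: eq_bigr => x _; case: (x \in S); rewrite ?expr1n ?expr0n. Qed.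

Lemma hoffman (S : {set T}) : {in S &, forall x y, ~~ e x y} ->
  #|S|%:R * (k%:R + m) <= m * #|T|%:R.
Proof.
move=> ind; have [->|S0] := eqVneq S set0.
  by rewrite cards0 mul0r mulr_ge0 // ltW.
have := quad_ge adjm_sym adjm_row adjm_sq r_ge0 m_gt0 srg_T_gt0 (fun x => (x \in S)%:R).
rewrite sum_ind sum_ind_sq big1 => [|x _].
  have s0 : 0 < #|S|%:R :> R by rewrite ltr0n card_gt0.
  by move=> h; rewrite -(ler_pM2r s0); lra.
have [xS|xS] := boolP (x \in S); last by rewrite mul0r.
rewrite mul1r big1 // => y _; have [yS|yS] := boolP (y \in S); last by rewrite mulr0.
by rewrite /adjm (negPf (ind _ _ xS yS)) mul0r.
Qed.

Hypothesis mu_gt0 : (0 < mu)%N.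

(** Feasibility turns Hoffman's bound [m v / (k + m)] into [m (k - r) / mu], and
    [m (k - r) = (m - 1) k + mu] is below [mu (k + 1)] exactly when [m - 1 < mu]. *)
Lemma indep_le_k (S : {set T}) : m - 1 < mu%:R ->
  {in S &, forall x y, ~~ e x y} -> (#|S| <= k)%N.
Proof.
move=> lmu /hoffman; have fe := srg_feasibility; set v := #|T|%:R in fe *.
set s := #|S|%:R => h; rewrite -ltnS -(ltr_nat R) -/s -natr1.
have k0 : 0 <= k%:R :> R by rewrite ler0n.
have mu0 : 0 < mu%:R :> R by rewrite ltr0n.
have km : 0 < k%:R + m by rewrite ltr_wpDl.
rewrite -(ltr_pM2r km); apply: le_lt_trans h _.
rewrite -(ltr_pM2r mu0).
have -> : m * v * mu%:R = m * (k%:R - r) * (k%:R + m) by rewrite -[RHS]mulrA -fe; ring.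
have kE : k%:R = mu%:R + r * m by rewrite rmE; ring.
have : 0 < (mu%:R + 1 - m) * k%:R * (k%:R + m).
  apply: mulr_gt0 => //; apply: mulr_gt0; first by lra.
  by rewrite kE ltr_pwDl // mulr_ge0 // ltW.
rewrite {1}kE; nra.
Qed.

Definition edges_in (S : {set T}) : R := \sum_(x in S) (deg_in e S x)%:R.

Lemma deg_in_eq0 (A B : {set T}) x : {in A & B, forall x y, ~~ e x y} ->
  x \in A -> deg_in e B x = 0%N.
Proof.
move=> nAB xA; apply/eqP; rewrite cards_eq0; apply/eqP/setP=> y; rewrite !inE.
by case: (boolP (y \in B)) => //= yB; apply/negbTE/nAB.
Qed.

(** The test function [|B| 1_A - |A| 1_B] has sum zero, so only [r] is left in [quad_le], and the
    missing edges between [A] and [B] remove the cross terms. *)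
Lemma edges_in_le (A B : {set T}) : A != set0 -> B != set0 -> [disjoint A & B] ->
  {in A & B, forall x y, ~~ e x y} ->
  edges_in A <= r * #|A|%:R \/ edges_in B <= r * #|B|%:R.
Proof.
move=> A0 B0 dAB nAB.
have nBA : {in B & A, forall x y, ~~ e x y}.
  by move=> x y xB yA; rewrite esym; apply: nAB.
have [leA|ltA] := leP (edges_in A) (r * #|A|%:R); first by left.
have [leB|ltB] := leP (edges_in B) (r * #|B|%:R); [by right | exfalso].
pose a : R := #|A|%:R; pose b : R := #|B|%:R.
have a0 : 0 < a by rewrite ltr0n card_gt0.
have b0 : 0 < b by rewrite ltr0n card_gt0.
pose f x : R := b * (x \in A)%:R - a * (x \in B)%:R.
have := quad_le adjm_sym adjm_row adjm_sq r_ge0 m_gt0 srg_T_gt0 f.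
have -> : \sum_x f x = 0.
  by rewrite sumrB -!mulr_sumr !sum_ind mulrC subrr.
have -> : \sum_x f x ^+ 2 = b ^+ 2 * a + a ^+ 2 * b.
  rewrite (eq_bigr (fun x => b ^+ 2 * (x \in A)%:R ^+ 2 + a ^+ 2 * (x \in B)%:R ^+ 2)).
    by rewrite big_split /= -!mulr_sumr !sum_ind_sq.
  move=> x _; rewrite /f; case: (boolP (x \in A)) => xA; last by rewrite /=; ring.
  by rewrite (disjointFr dAB xA) /=; ring.
have -> : \sum_x f x * \sum_y adjm x y * f y = b ^+ 2 * edges_in A + a ^+ 2 * edges_in B.
  rewrite /edges_in [\sum_(x in A) _]big_mkcond [\sum_(x in B) _]big_mkcond /=.
  rewrite !mulr_sumr -big_split /=; apply: eq_bigr => x _.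
  have -> : \sum_y adjm x y * f y = b * (deg_in e A x)%:R - a * (deg_in e B x)%:R.
    rewrite -!adjm_sum !mulr_sumr -sumrB; apply: eq_bigr => y _; rewrite /f; ring.
  rewrite /f; case: (boolP (x \in A)) => xA.
    by rewrite (disjointFr dAB xA) (deg_in_eq0 nAB xA) /=; ring.
  case: (boolP (x \in B)) => xB; last by rewrite /=; ring.
  by rewrite (deg_in_eq0 nBA xB) /=; ring.
have v0 : 0 < #|T|%:R :> R by rewrite ltr0n srg_T_gt0.
rewrite [leRHS](_ : _ = #|T|%:R * (r * (b ^+ 2 * a + a ^+ 2 * b))); last by ring.
rewrite ler_pM2l // leNgt => /negP; apply.
have h1 : b ^+ 2 * (r * a) < b ^+ 2 * edges_in A by rewrite ltr_pM2l // exprn_gt0.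
have h2 : a ^+ 2 * (r * b) < a ^+ 2 * edges_in B by rewrite ltr_pM2l // exprn_gt0.
lra.
Qed.

(** All [(k - D) |A|] edges leaving [A] end in [C], where [D] is the average inner degree. The sum
    of [d x ^+ 2] counts walks of length two from [A] to [A]; at least [D^2 |A|] of them have their
    midpoint in [A], and Cauchy-Schwarz on [C] compares the rest with the edges. *)
Lemma separator_ge_of_edges_in (A B : {set T}) : 2 <= m -> A != set0 -> [disjoint A & B] ->
  {in A & B, forall x y, ~~ e x y} -> edges_in A <= r * #|A|%:R ->
  (k <= #|~: (A :|: B)|)%N.
Proof.
move=> m2 A0 dAB nAB leE; rewrite leqNgt; apply/negP=> ltk.
set C := ~: (A :|: B) in ltk.
have nBA : {in B & A, forall x y, ~~ e x y}.
  by move=> x y xB yA; rewrite esym; apply: nAB.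
pose a : R := #|A|%:R; pose d x : R := (deg_in e A x)%:R.
have a0 : 0 < a by rewrite ltr0n card_gt0.
have split3 (g : T -> R) : (forall x, x \in B -> g x = 0) ->
    \sum_x g x = \sum_(x in A) g x + \sum_(x in C) g x.
  move=> gB; rewrite (bigID (mem A)) /=; congr (_ + _).
  rewrite (bigID (mem B)) /= big1 ?add0r => [|x /andP[_ xB]]; last exact: gB.
  by apply: eq_bigl => x; rewrite !inE negb_or.
have dB x : x \in B -> d x = 0 by move=> xB; rewrite /d (deg_in_eq0 nBA xB).
have s1 : k%:R * a = edges_in A + \sum_(x in C) d x.
  rewrite -[edges_in A]/(\sum_(x in A) d x) -split3 // /a -sum_ind.
  rewrite -(sum_act adjm_sym adjm_row); apply: eq_bigr => x _.
  by rewrite adjm_sum.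
have s2 : \sum_(x in A) d x ^+ 2 + \sum_(x in C) d x ^+ 2 =
    r * m * a + (r - m) * edges_in A + mu%:R * a ^+ 2.
  rewrite -split3; last by move=> x xB; rewrite dB // expr0n.
  have := nrm_act adjm_sym adjm_sq (fun x => (x \in A)%:R).
  rewrite sum_ind sum_ind_sq.
  have -> : \sum_x (x \in A)%:R * (\sum_y adjm x y * (y \in A)%:R) = edges_in A.
    rewrite /edges_in [RHS]big_mkcond; apply: eq_bigr => x _; rewrite adjm_sum.
    by case: (x \in A); rewrite ?mul1r ?mul0r.
  by move=> <-; apply: eq_bigr => x _; rewrite adjm_sum.
have q1 : edges_in A ^+ 2 <= a * \sum_(x in A) d x ^+ 2 by apply: sqr_sum_le.
have q2 : (\sum_(x in C) d x) ^+ 2 <= #|C|%:R * \sum_(x in C) d x ^+ 2 by apply: sqr_sum_le.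
have d1 : edges_in A <= a * (a - 1).
  rewrite /a mulrC mulr_natr -sumr_const; apply: ler_sum => x xA.
  rewrite lerBrDr natr1 ler_nat; apply: proper_card; apply/properP; split.
    by apply/subsetP=> y; rewrite inE => /andP[].
  by exists x; rewrite // inE eirr andbF.
have e0 : 0 <= edges_in A by apply: sumr_ge0 => x _; rewrite ler0n.
pose D := edges_in A / a.
have DE : edges_in A = D * a by rewrite /D divfK // gt_eqF.
move: s1 s2 q1 d1 e0 leE; rewrite DE => s1 s2 q1 d1 e0 leE.
have t0 : 0 <= #|C|%:R :> R by rewrite ler0n.
apply: (@separator_arith R r k%:R m a D #|C|%:R mu%:R) => //.
- by rewrite -(pmulr_lge0 _ a0) e0 -(ler_pM2r a0).
- by rewrite -(ler_pM2r a0); lra.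
- by rewrite ltr0n.
- by rewrite rmE; ring.
- by rewrite t0 ltr_nat.
rewrite -(ler_pM2r a0).
have -> : a * (k%:R - D) ^+ 2 * a = (\sum_(x in C) d x) ^+ 2.
  have -> : \sum_(x in C) d x = k%:R * a - D * a by rewrite s1; ring.
  ring.
apply: le_trans q2 _; rewrite -mulrA ler_wpM2l //.
have : D ^+ 2 * a <= \sum_(x in A) d x ^+ 2.
  by rewrite -(ler_pM2l a0); apply: le_trans q1; rewrite le_eqVlt; apply/orP; left; apply/eqP; ring.
lra.
Qed.

Lemma separator_ge (A B : {set T}) : 2 <= m ->
  A != set0 -> B != set0 -> [disjoint A & B] ->
  {in A & B, forall x y, ~~ e x y} -> (k <= #|~: (A :|: B)|)%N.
Proof.
move=> m2 A0 B0 dAB nAB; case: (edges_in_le A0 B0 dAB nAB) => h.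
  exact: separator_ge_of_edges_in.
rewrite setUC; apply: separator_ge_of_edges_in => //; first by rewrite disjoint_sym.
by move=> x y xB yA; rewrite esym; apply: nAB.
Qed.

Theorem srg_hamiltonian_of_mu_gt : (3 <= #|T|)%N -> 2 <= m -> m - 1 < mu%:R -> hamiltonian e.
Proof.
move=> T3 m2 lmu; apply: (@hamiltonian_of_indep_le_connectivity T e esym k) => //.
  by move=> S; apply: indep_le_k.
by move=> A B; apply: separator_ge.
Qed.

Lemma sum_proj_cube x : \sum_y proj adjm k%:R r x y ^+ 3 =
  let c := (k%:R - r) / #|T|%:R in
  #|T|%:R * c ^+ 3 + ((r + c) ^+ 3 - c ^+ 3) + k%:R * ((c - 1) ^+ 3 - c ^+ 3).
Proof.
set c := _ / _; rewrite /=.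
rewrite (eq_bigr (fun y => c ^+ 3 + (x == y)%:R * ((r + c) ^+ 3 - c ^+ 3)
  + adjm x y * ((c - 1) ^+ 3 - c ^+ 3))); last first.
  move=> y _; rewrite /proj -/c /adjm; case: eqVneq => [<-|_].
    by rewrite eirr /=; ring.
  by case: (e x y) => /=; ring.
rewrite !big_split /= sumr_const cardT -cardE -[_ *+ #|T|]mulr_natl -!mulr_suml adjm_row.
have -> : \sum_y (x == y)%:R = 1 :> R.
  by have := sum_delta (fun=> 1 : R) x; under eq_bigr do rewrite mulr1.
by rewrite mul1r.
Qed.

(** After clearing denominators with [c * (k + m) = mu], the nonnegative sum of cubes acquires the
    factor [r + 1], which is cancelled here; the common factor [k] remains on both sides. *)
Lemma krein_condition :
  (m - 1) * (r * m + m - mu%:R) * k%:R <= (k%:R - m) * (r + 1) ^+ 2 * k%:R.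
Proof.
have v0 : 0 < #|T|%:R :> R by rewrite ltr0n srg_T_gt0.
have := sum_proj_cube_ge0 adjm_sym adjm_row adjm_sq r_ge0 m_gt0 srg_T_gt0.
under eq_bigr => x _ do rewrite sum_proj_cube /=.
rewrite sumr_const cardT -cardE pmulrn_lge0; last exact: srg_T_gt0.
have fe := srg_feasibility; set v := #|T|%:R in v0 fe *; set c := _ / v.
have cv : c * v = k%:R - r by rewrite /c divfK // gt_eqF.
have ck : c * (k%:R + m) = mu%:R.
  by apply: (mulIf (lt0r_neq0 v0)); rewrite fe mulrAC cv.
have kE : k%:R = mu%:R + r * m by rewrite rmE; ring.
have km : 0 < k%:R + m by rewrite ltr_wpDl // ler0n.
move=> h.
have h1 : 0 <= - 2 * (k%:R - r) * c ^+ 2 + 3 * c * (r ^+ 2 + k%:R) + r ^+ 3 - k%:R.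
  have -> : 3 * c * (r ^+ 2 + k%:R) = 3 * c * r ^+ 2 + 3 * c * k%:R by ring.
  apply: le_trans h _; rewrite le_eqVlt; apply/orP; left; apply/eqP.
  have -> : v * c ^+ 3 = (k%:R - r) * c ^+ 2 by rewrite -cv; ring.
  ring.
have h2 : 0 <= - 2 * (k%:R - r) * mu%:R ^+ 2 + 3 * mu%:R * (k%:R + m) * (r ^+ 2 + k%:R)
     + (r ^+ 3 - k%:R) * (k%:R + m) ^+ 2.
  have := mulr_ge0 h1 (exprn_ge0 2 (ltW km)); rewrite -ck.
  by congr (_ <= _); ring.
have r1 : 0 < r + 1 by rewrite ltr_wpDl.
rewrite -subr_ge0 -(pmulr_rge0 _ r1).
apply: le_trans h2 _; rewrite le_eqVlt; apply/orP; left; apply/eqP.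
rewrite kE; ring.
Qed.

(** * Distribution of degrees into a set *)

Section Mixing.
Variables (M s : R).
Hypotheses (rM : r <= M) (mM : m <= M) (s_ge0 : 0 <= s) (sM : s * M <= k%:R).

Lemma deg_variance (A : {set T}) :
  \sum_x (#|T|%:R * (deg_in e A x)%:R - k%:R * #|A|%:R) ^+ 2 <= #|T|%:R ^+ 2 * M ^+ 2 * #|A|%:R.
Proof.
have := variance_le adjm_sym adjm_row adjm_sq r_ge0 m_gt0 srg_T_gt0 (fun x => (x \in A)%:R) rM mM.
rewrite sum_ind sum_ind_sq; apply: le_trans; rewrite le_eqVlt; apply/orP; left; apply/eqP.
by apply: eq_bigr => x _; rewrite adjm_sum.
Qed.

(** The scalar [b] clears the constant in the deviation: [2 c] for vertices above the mean, [- 2]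
    for those below. *)
Lemma deg_chebyshev (A S : {set T}) (w b : R) :
  {in S, forall x, w <= (b * (#|T|%:R * (deg_in e A x)%:R - k%:R * #|A|%:R)) ^+ 2} ->
  #|S|%:R * w <= b ^+ 2 * (#|T|%:R ^+ 2 * M ^+ 2 * #|A|%:R).
Proof.
move=> hS; apply: (@le_trans _ _ (b ^+ 2 *
    \sum_x (#|T|%:R * (deg_in e A x)%:R - k%:R * #|A|%:R) ^+ 2)); last first.
  by rewrite ler_wpM2l ?sqr_ge0 // deg_variance.
rewrite mulr_natl -sumr_const mulr_sumr [leRHS](bigID (mem S)) /=.
rewrite -[leLHS]addr0; apply: lerD.
  by apply: ler_sum => x xS; rewrite -exprMn; apply: hS.
by apply: sumr_ge0 => x _; rewrite -exprMn sqr_ge0.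
Qed.

Lemma srg_mixing_upper (c : nat) (S A : {set T}) :
  {in S, forall x, (k <= c * deg_in e A x)%N} -> (2 * c * #|A| <= #|T|)%N ->
  s ^+ 2 * #|S|%:R <= 4 * c%:R ^+ 2 * #|A|%:R.
Proof.
move=> hS hA; set v := #|T|%:R : R.
have v0 : 0 < v by rewrite ltr0n srg_T_gt0.
have M0 : 0 < M by apply: lt_le_trans mM.
have hA' : 2 * c%:R * #|A|%:R <= v by rewrite -!natrM ler_nat.
have k0 : 0 <= k%:R :> R by rewrite ler0n.
have hw : {in S, forall x, (v * k%:R) ^+ 2 <=
    (2 * c%:R * (v * (deg_in e A x)%:R - k%:R * #|A|%:R)) ^+ 2}.
  move=> x xS.
  have kd : k%:R <= c%:R * (deg_in e A x)%:R :> R by rewrite -natrM ler_nat hS.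
  have h : v * k%:R <= 2 * c%:R * (v * (deg_in e A x)%:R - k%:R * #|A|%:R).
    have h1 : v * k%:R <= v * (c%:R * (deg_in e A x)%:R) by rewrite ler_pM2l.
    have h2 : k%:R * (2 * c%:R * #|A|%:R) <= k%:R * v by rewrite ler_wpM2l.
    lra.
  have vk : 0 <= v * k%:R by rewrite mulr_ge0 // ltW.
  by rewrite lerXn2r ?nnegrE // (le_trans vk h).
have := deg_chebyshev hw; rewrite -/v => h.
have h3 : #|S|%:R * k%:R ^+ 2 <= 4 * c%:R ^+ 2 * #|A|%:R * M ^+ 2.
  rewrite -(ler_pM2l (exprn_gt0 2 v0)); lra.
rewrite -(ler_pM2r (exprn_gt0 2 M0)); apply: le_trans h3.
have -> : s ^+ 2 * #|S|%:R * M ^+ 2 = #|S|%:R * (s * M) ^+ 2 by ring.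
by rewrite ler_wpM2l ?ler0n // lerXn2r ?nnegrE ?mulr_ge0 ?ler0n // ltW.
Qed.

Lemma srg_mixing_lower (c : nat) (S A : {set T}) :
  {in S, forall x, (2 * c * deg_in e A x < k)%N} -> (#|T| <= c * #|A|)%N ->
  s ^+ 2 * #|S|%:R <= 4 * c%:R * #|T|%:R.
Proof.
move=> hS hA; set v := #|T|%:R : R.
have v0 : 0 < v by rewrite ltr0n srg_T_gt0.
have M0 : 0 < M by apply: lt_le_trans mM.
have hA' : v <= c%:R * #|A|%:R by rewrite -!natrM ler_nat.
have A0 : 0 < #|A|%:R :> R.
  by rewrite ltr0n lt0n; apply: contraTneq hA => ->; rewrite muln0 -ltnNge srg_T_gt0.
have k0 : 0 <= k%:R :> R by rewrite ler0n.
have hw : {in S, forall x, (k%:R * #|A|%:R) ^+ 2 <=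
    ((- 2) * (v * (deg_in e A x)%:R - k%:R * #|A|%:R)) ^+ 2}.
  move=> x xS.
  have kd : 2 * c%:R * (deg_in e A x)%:R <= k%:R :> R by rewrite -!natrM ler_nat ltnW // hS.
  have h : k%:R * #|A|%:R <= (- 2) * (v * (deg_in e A x)%:R - k%:R * #|A|%:R).
    have h1 : (deg_in e A x)%:R * v <= (deg_in e A x)%:R * (c%:R * #|A|%:R).
      by rewrite ler_wpM2l // ler0n.
    have h2 : 2 * c%:R * (deg_in e A x)%:R * #|A|%:R <= k%:R * #|A|%:R :> R.
      by rewrite ler_pM2r.
    lra.
  have vk : 0 <= k%:R * #|A|%:R :> R by rewrite mulr_ge0 // ltW.
  by rewrite lerXn2r ?nnegrE // (le_trans vk h).
have := deg_chebyshev hw; rewrite -/v => h.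
have h3 : #|S|%:R * k%:R ^+ 2 * #|A|%:R <= 4 * v ^+ 2 * M ^+ 2.
  rewrite -(ler_pM2r A0); lra.
have h4 : s ^+ 2 * #|S|%:R * #|A|%:R <= 4 * v ^+ 2.
  rewrite -(ler_pM2r (exprn_gt0 2 M0)); apply: le_trans h3.
  have -> : s ^+ 2 * #|S|%:R * #|A|%:R * M ^+ 2 = #|S|%:R * (s * M) ^+ 2 * #|A|%:R by ring.
  by rewrite ler_pM2r // ler_wpM2l ?ler0n // lerXn2r ?nnegrE ?mulr_ge0 ?ler0n // ltW.
have c0 : 0 <= c%:R :> R by rewrite ler0n.
have sS : 0 <= s ^+ 2 * #|S|%:R by rewrite mulr_ge0 ?sqr_ge0 ?ler0n.
rewrite -(ler_pM2r v0); apply: (@le_trans _ _ (s ^+ 2 * #|S|%:R * (c%:R * #|A|%:R))).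
  by rewrite ler_wpM2l.
have := ler_wpM2l c0 h4; lra.
Qed.
End Mixing.
End Eigenvalues.
End StronglyRegular.

(* Claws and the size of the parameters *)
Local Close Scope ring_scope.

(** Bonferroni's inequality, with the number of pairs rounded up to a square. *)
Lemma card_bigcup_ge (I T : finType) (s : seq I) (M : I -> {set T}) (L mu : nat) :
  uniq s -> {in s, forall y, #|M y| = L} ->
  {in s &, forall y z, y != z -> #|M y :&: M z| <= mu} ->
  size s * L <= #|\bigcup_(y <- s) M y| + size s ^ 2 * mu.
Proof.
elim: s => [|y s IH] //= /andP[ys us] cM iM; rewrite big_cons.
have sub z : z \in s -> z \in y :: s by rewrite inE orbC => ->.
have := IH us (fun z zs => cM z (sub z zs)) (fun z w zs ws => iM z w (sub z zs) (sub w ws)).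
set U := \bigcup_(z <- s) M z => h.
have cy := cM y (mem_head _ _).
have : #|M y :&: U| <= size s * mu.
  have : {in s, forall z, #|M y :&: M z| <= mu}.
    move=> z zs; apply: iM; rewrite ?mem_head ?sub //.
    by apply: contraNneq ys => ->.
  rewrite /U; elim: (s) => [|z t IHt] hz; first by rewrite big_nil setI0 cards0.
  rewrite big_cons setIUr mulSn; apply: leq_trans (card_setU_le _ _) _.
  apply: leq_add; first by apply: hz; rewrite mem_head.
  by apply: IHt => w wt; apply: hz; rewrite inE wt orbT.
have := cardsUI (M y) U; rewrite cy; nia.
Qed.

(* The neighbourhood of a vertex is [lam]-regular on [k > m * lam.+1] vertices, so
   it has [m.+1] independent vertices, which pairwise have at most [mu] common
   neighbours. *)
Lemma claw_bound (T : finType) (e : rel T) (k lam mu r m : nat) :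
  srg e #|T| k lam mu -> k = mu + r * m -> lam + m = mu + r -> 0 < mu < m ->
  m.+1 * lam.+1 <= k + m.+1 ^ 2 * mu.
Proof.
case=> -[esym eirr] [_ [deg [hlam [hmu [_ [x [y0 exy0]]]]]]] kE lamE /andP[mu0 mum].
pose N := [set y | e x y]; pose M y := [set z in N | (z == y) || e y z].
have cM y : y \in N -> #|M y| = lam.+1.
  rewrite inE => yN; have -> : M y = y |: [set z | e x z && e y z].
    apply/setP=> z; rewrite !inE; case: eqVneq => [->|//] /=.
    by rewrite yN.
  by rewrite cardsU1 hlam // inE eirr andbF.
have iM y z : y \in N -> z \in N -> y != z -> ~~ e y z -> #|M y :&: M z| <= mu.
  move=> yN zN nyz eyz; rewrite -(hmu y z nyz eyz); apply: subset_leq_card.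
  apply/subsetP=> w; rewrite !inE => /andP[/andP[_ h1] /andP[_ h2]].
  case: eqVneq h1 h2 => [->|_] /= h1 h2.
    by move: h2; rewrite (negPf nyz) esym (negPf eyz).
  by case: eqVneq h2 => [wz|_] /= h2; [rewrite -wz h1 in eyz|rewrite h1 h2].
pose P (S : {set T}) := (S \subset N) && [forall y in S, forall z in S, ~~ e y z].
have P0 : P set0 by rewrite /P sub0set; apply/forall_inP=> y; rewrite inE.
have [I /maxsetP[/andP[sI /forall_inP iI] mI] _] := maxset_exists P0.
have indI y z : y \in I -> z \in I -> ~~ e y z by move=> /iI/forall_inP; apply.
have cov : N \subset \bigcup_(y in I) M y.
  apply/subsetP=> z zN; apply: contraT => zU.
  have zI y : y \in I -> ~~ ((z == y) || e y z).
    move=> yI; apply: contra zU => h; apply/bigcupP; exists y => //.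
    by rewrite inE zN.
  have nzI : z \notin I by apply/negP=> /zI; rewrite eqxx.
  have E : z |: I = I.
    apply: mI; last exact: subsetUr.
    rewrite /P subUset sub1set zN sI /=; apply/forall_inP=> u uI; apply/forall_inP=> w wI.
    case/setU1P: uI => [->|uI]; case/setU1P: wI => [->|wI].
    - by rewrite eirr.
    - by rewrite esym; have := zI w wI; rewrite negb_or => /andP[].
    - by have := zI u uI; rewrite negb_or => /andP[].
    by apply: indI.
  by rewrite -E setU11 in nzI.
have leI : k <= #|I| * lam.+1.
  rewrite -(deg x); apply: leq_trans (subset_leq_card cov) _.
  have : #|\bigcup_(y in I) M y| <= \sum_(y in I) #|M y|.
    elim/big_ind2: _ => [|A1 n1 A2 n2 h1 h2|//]; first by rewrite cards0.
    exact: leq_trans (card_setU_le _ _) (leq_add h1 h2).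
  move/leq_trans; apply; rewrite -sum_nat_const; apply: leq_sum => y yI.
  by rewrite cM // (subsetP sI).
have ltI : m < #|I|.
  rewrite ltnNge; apply/negP=> leIm.
  have : k <= m * lam.+1 by apply: leq_trans leI _; rewrite leq_mul2r leIm orbT.
  (* Thus [m (lam + 1) = r m - m (m - mu - 1)], at most [r m], hence below [k]. *)
  rewrite kE; have -> : lam.+1 = (r - (m - mu.+1)) by lia.
  rewrite mulnBr; nia.
pose s := take m.+1 (enum I).
have ss : size s = m.+1 by rewrite size_takel // -cardE.
have sI' y : y \in s -> y \in I by move=> /mem_take; rewrite mem_enum.
have us : uniq s by rewrite take_uniq // enum_uniq.
have sN y : y \in s -> y \in N by move=> /sI'; apply: (subsetP sI).
have := card_bigcup_ge (M := M) (L := lam.+1) (mu := mu) us.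
rewrite ss => h; apply: leq_trans (h _ _) _.
- by move=> y ys; apply: cM; apply: sN.
- by move=> y z ys zs nyz; apply: iM => //; rewrite ?sN // indI // sI'.
rewrite leq_add2r -(deg x); apply: subset_leq_card.
elim/big_ind: _ => [|A B|y _]; [exact: sub0set|by rewrite subUset => -> ->|].
by apply/subsetP=> z; rewrite !inE => /andP[-> _].
Qed.

(** The terms [r m] nearly cancel, leaving one [r] bounded by three terms. For [m >= 2] these are at
    most [1/4], [9/4] and [6/4] times [m^2 mu], which add up to the constant [4]. *)
Lemma claw_bound_eigenvalue (r m mu lam k : nat) :
  0 < mu < m -> k = mu + r * m -> lam + m = mu + r ->
  m.+1 * lam.+1 <= k + m.+1 ^ 2 * mu -> r <= 4 * m ^ 2 * mu.
Proof.
move=> /andP[mu0 mum] -> lamE h.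
have h1 : m.+1 * (mu + r).+1 <= mu + r * m + m.+1 ^ 2 * mu + m.+1 * m.
  by rewrite -lamE -addSn mulnDr leq_add2r.
have h2 : r <= mu + m.+1 ^ 2 * mu + m.+1 * m by nia.
have m2 : 1 < m by lia.
have h3 : 4 * m.+1 ^ 2 <= 9 * m ^ 2 by nia.
have h4 : 4 * (m.+1 * m) <= 6 * m ^ 2 by nia.
have h5 : 4 <= m ^ 2 by nia.
have h6 : 4 * (m.+1 ^ 2 * mu) <= 9 * m ^ 2 * mu by rewrite mulnA leq_mul2r h3 orbT.
have h7 : m ^ 2 <= m ^ 2 * mu by rewrite leq_pmulr.
have h8 : 4 * mu <= m ^ 2 * mu by rewrite leq_mul2r h5 orbT.
lia.
Qed.

(** If [r < L] then [m <= L^2 + 1], and if [m < L] then [r <= 4 L^3], so one small eigenvalue bounds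
    both by [X]; then [k <= X + X^2] and [v <= k (k + m)] is bounded too. *)
Lemma eigenvalues_large (L : nat) : exists N, forall r m mu k v : nat,
  0 < mu < m -> k = mu + r * m -> r <= 4 * m ^ 2 * mu -> m <= r.+1 ^ 2 + 1 ->
  mu * v <= k * (k + m) -> N < v -> L <= r /\ L <= m.
Proof.
pose X := L ^ 2 + 1 + 4 * L ^ 3 + L.
exists ((X + X * X) * (X + X * X + X)) => r m mu k v /andP[mu0 mum] kE rle mle vle ltv.
suff h : ~ (r <= X /\ m <= X).
  split; rewrite leqNgt; apply/negP=> lt; apply: h.
    have : r.+1 ^ 2 <= L ^ 2 by rewrite leq_sqr.
    rewrite /X; lia.
  have h1 : m ^ 3 <= L ^ 3 by rewrite leq_exp2r // ltnW.
  have h2 : 4 * m ^ 2 * mu <= 4 * m ^ 3.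
    by rewrite (expnSr m 2) -!mulnA !leq_mul2l (ltnW mum) !orbT.
  rewrite /X; lia.
case=> rX mX; move: ltv; apply/negP; rewrite -leqNgt.
apply: (@leq_trans (mu * v)); first by rewrite leq_pmull.
apply: leq_trans vle _.
have kX : k <= X + X * X by rewrite kE leq_add ?leq_mul //; apply: leq_trans mX; apply: ltnW.
by rewrite leq_mul // leq_add.
Qed.

(** By [mu v <= 2 k^2] the last condition reduces to [16000 k <= mu min(r, m)^4]. For [r <= m],
    [k <= 3 r^2 mu]; for [m < r], [k <= 5 m^3 mu], so that [m >= 5 * 16000] is what is required:
    this fixes [80 * 1000]. *)
Lemma mixing_arith (r m mu k v L : nat) : 80 * 1000 <= L -> L <= r -> L <= m ->
  0 < mu < m -> k = mu + r * m -> r <= 4 * m ^ 2 * mu -> m <= mu + r ->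
  mu * v = (k - r) * (k + m) ->
  [/\ 200 * 1000 <= minn r m ^ 2, 4 <= k, 4 * k <= v, 1000 <= v &
      8 * 1000 * v <= k * (minn r m ^ 2) ^ 2].
Proof.
move=> L0 Lr Lm /andP[mu0 mum] kE rle mle vE.
have kr : r * mu <= k - r.
  have : r * mu.+1 <= r * m by rewrite leq_mul2l mum orbT.
  rewrite kE mulnS; lia.
have rkv : r * k <= v.
  rewrite -(leq_pmul2l mu0) vE (mulnCA mu) mulnA.
  by apply: leq_mul => //; lia.
have km : m <= k.
  by rewrite kE; apply: leq_trans (leq_addl _ _); apply: leq_pmull; lia.
have k1000 : 1000 <= k by lia.
have min0 : 80 * 1000 <= minn r m by lia.
split.
- apply: leq_trans (_ : (80 * 1000) * (80 * 1000) <= _); first by lia.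
  by rewrite -[minn r m ^ 2]/(minn r m * minn r m) leq_mul.
- by lia.
- by apply: leq_trans rkv; rewrite leq_mul2r; lia.
- by apply: leq_trans rkv; apply: leq_trans k1000 _; apply: leq_pmull; lia.
have v2 : mu * v <= k * (2 * k).
  by rewrite vE leq_mul ?leq_subr // mul2n -addnn leq_add2l.
suff h : 16 * 1000 * k <= mu * (minn r m ^ 2) ^ 2.
  rewrite -(leq_pmul2l mu0).
  have -> : mu * (8 * 1000 * v) = 8 * 1000 * (mu * v) by lia.
  apply: (@leq_trans (8 * 1000 * (k * (2 * k)))); first by rewrite leq_mul2l v2 orbT.
  have -> : 8 * 1000 * (k * (2 * k)) = k * (16 * 1000 * k) by lia.
  have -> : mu * (k * (minn r m ^ 2) ^ 2) = k * (mu * (minn r m ^ 2) ^ 2) by rewrite mulnCA.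
  by rewrite leq_mul2l h orbT.
have [rm|mr] := leqP r m.
  have k3 : k <= 3 * (r ^ 2 * mu).
    have h1 : r * m <= r * mu + r * r by rewrite -mulnDr leq_mul2l mle orbT.
    have h2 : r * r <= r ^ 2 * mu by rewrite -[r ^ 2]/(r * r) leq_pmulr.
    have h3 : r * mu <= r ^ 2 * mu by rewrite leq_mul2r -[r ^ 2]/(r * r) leq_pmulr ?orbT //; lia.
    have h4 : mu <= r * mu by apply: leq_pmull; lia.
    rewrite kE; lia.
  apply: (@leq_trans (16 * 1000 * (3 * (r ^ 2 * mu)))); first by rewrite leq_mul2l k3 orbT.
  have h5 : 16 * 1000 * 3 <= r ^ 2.
    by apply: (@leq_trans (r * 1)); [lia | rewrite -[r ^ 2]/(r * r) leq_mul //; lia].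
  have -> : 16 * 1000 * (3 * (r ^ 2 * mu)) = 16 * 1000 * 3 * (r ^ 2 * mu) by lia.
  have -> : mu * (r ^ 2) ^ 2 = r ^ 2 * (r ^ 2 * mu).
    by rewrite -[(r ^ 2) ^ 2]/(r ^ 2 * r ^ 2) mulnC -mulnA.
  by rewrite leq_mul2r h5 orbT.
have k5 : k <= 5 * (m ^ 3 * mu).
  have h1 : r * m <= 4 * m ^ 2 * mu * m by rewrite leq_mul2r rle orbT.
  have h2 : mu <= m ^ 3 * mu by apply: leq_pmull; rewrite expn_gt0; lia.
  have h3 : 4 * m ^ 2 * mu * m = 4 * (m ^ 3 * mu) by rewrite (expnSr m 2); lia.
  rewrite kE; lia.
apply: (@leq_trans (16 * 1000 * (5 * (m ^ 3 * mu)))); first by rewrite leq_mul2l k5 orbT.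
have -> : 16 * 1000 * (5 * (m ^ 3 * mu)) = 80 * 1000 * (m ^ 3 * mu) by lia.
have -> : mu * (m ^ 2) ^ 2 = m * (m ^ 3 * mu).
  by rewrite -expnM (expnS m 3) mulnC mulnA.
by rewrite leq_mul2r (leq_trans L0 Lm) orbT.
Qed.

(** * Integrality of the eigenvalues *)

Local Open Scope ring_scope.

(** From [s^2 D = t^2] the integer [s] divides [t]. *)
Lemma int_sqrt_of_rational (R : realFieldType) (d : R) (D : nat) (s t : int) :
  0 <= d -> d ^+ 2 = D%:R -> s != 0 -> s%:~R * d = t%:~R -> exists n : nat, d = n%:R.
Proof.
move=> d0 dD s0 sd.
have h : s ^+ 2 * D%:Z = t ^+ 2.
  apply: (@intr_inj R); rewrite rmorphM !rmorphXn /= -sd exprMn dD.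
  by rewrite -pmulrn.
have hn : (`|s| ^ 2 * D = `|t| ^ 2)%N.
  by rewrite -!abszX -h abszM absz_nat.
have /dvdnP[n tE] : (`|s| %| `|t|)%N.
  by rewrite -(@dvdn_pexp2r _ _ 2) // -hn dvdn_mulr.
have Dn : D = (n ^ 2)%N.
  apply/eqP; rewrite -(@eqn_pmul2l (`|s| ^ 2)) ?expn_gt0 ?absz_gt0 ?s0 //.
  by rewrite hn tE expnMn mulnC.
exists n; apply/eqP; rewrite -(@eqrXn2 _ 2) ?ler0n //.
by rewrite dD Dn natrX.
Qed.

Lemma srg_eigenvalues (R : rcfType) (T : finType) (e : rel T) (k lam mu : nat) :
  srg e #|T| k lam mu -> connected_graph e ->
  exists r m : R, [/\ r * m = k%:R - mu%:R, r - m = lam%:R - mu%:R, 0 <= r, 1 < m &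
    (exists r' m' : nat, r = r'%:R /\ m = m'%:R) \/
    [/\ mu = lam.+1, k = (2 * mu)%N & #|T| = (4 * mu).+1]].
Proof.
move=> esrg conn; have mu0 := srg_mu_gt0 esrg conn.
have muk := srg_mu_le esrg; have kT := srg_k_lt esrg; have T0 := srg_T_gt0 esrg.
pose D : R := (lam%:R - mu%:R) ^+ 2 + 4 * (k%:R - mu%:R).
have kmu : 0 <= k%:R - mu%:R :> R by rewrite subr_ge0 ler_nat.
have D0 : 0 <= D by rewrite addr_ge0 ?sqr_ge0 // mulr_ge0.
pose d := Num.sqrt D; have d0 : 0 <= d by apply: sqrtr_ge0.
have dD : d ^+ 2 = D by apply: sqr_sqrtr.
have dge : `|lam%:R - mu%:R| <= d.
  rewrite -ler_sqr ?nnegrE // dD real_normK ?num_real //.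
  by rewrite lerDl mulr_ge0.
have /andP[dge1 dge2] : - d <= lam%:R - mu%:R <= d by rewrite -ler_norml.
pose r := (lam%:R - mu%:R + d) / 2; pose m := (mu%:R - lam%:R + d) / 2.
have rmE : r * m = k%:R - mu%:R.
  have : r * m = (d ^+ 2 - (lam%:R - mu%:R) ^+ 2) / 4 by rewrite /r /m; field.
  by rewrite dD /D => ->; field.
have rBm : r - m = lam%:R - mu%:R by rewrite /r /m; field.
have r0 : 0 <= r by rewrite /r; lra.
have fe := srg_feasibility esrg rmE rBm.
have mur : 0 < mu%:R :> R by rewrite ltr0n.
have fe2 : mu%:R * (#|T|%:R - 1 - k%:R) = k%:R * (k%:R - 1 - lam%:R) :> R.
  have -> : mu%:R * (#|T|%:R - 1 - k%:R) = mu%:R * #|T|%:R - mu%:R - mu%:R * k%:R :> R by ring.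
  have -> : k%:R * (k%:R - 1 - lam%:R) = k%:R * k%:R - k%:R - k%:R * lam%:R :> R by ring.
  rewrite fe.
  have -> : (k%:R - r) * (k%:R + m) = k%:R * k%:R - (r - m) * k%:R - r * m by ring.
  by rewrite rmE rBm; ring.
have kT' : 0 < #|T|%:R - 1 - k%:R :> R.
  by rewrite -addrA -opprD subr_gt0 nat1r ltr_nat.
have k0 : 0 < k%:R :> R by apply: lt_le_trans mur _; rewrite ler_nat.
have kl : 0 < k%:R - 1 - lam%:R :> R.
  by rewrite -(pmulr_rgt0 _ k0) -fe2 mulr_gt0.
(* [(r + 1) (m - 1) = k - 1 - lam], which is positive because the graph is not complete. *)
have m1 : 1 < m.
  rewrite -subr_gt0 -(@pmulr_rgt0 _ (r + 1)); last by rewrite ltr_wpDl.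
  by have -> : (r + 1) * (m - 1) = k%:R - 1 - lam%:R by
    have -> : (r + 1) * (m - 1) = r * m - (r - m) - 1 by [ring]; rewrite rmE rBm; ring.
exists r, m; split=> //.
have m0 : 0 < m by lra.
have aii x : adjm e R x x = 0 by rewrite /adjm; case: esrg => -[_ ->].
have [g gE] := multiplicity (adjm_sym esrg R) (adjm_row esrg R)
  (adjm_sq esrg rmE rBm) r0 m0 T0 aii.
(* [s] is the difference of the multiplicities of [- m] and [r]. Unless it vanishes, the trace
   identity makes [d = r + m] rational. *)
pose s : int := Posz (2 * g) - (Posz #|T| - Posz 1).
pose t : int := (Posz #|T| - Posz 1) * (Posz lam - Posz mu) + Posz (2 * k).
have st : s%:~R * d = t%:~R.
  rewrite /s /t !(intrB, intrD, intrM) -!pmulrn !natrM.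
  have dE : d = r + m by rewrite /r /m; field.
  have rE : lam%:R - mu%:R = r - m by [].
  rewrite rE dE; have -> : (2 * g%:R - (#|T|%:R - 1)) * (r + m) =
    2 * (g%:R * (r + m)) - (#|T|%:R - 1) * (r + m) by ring.
  by rewrite gE; ring.
have [s0|s0] := eqVneq s 0; [right|left]; last first.
  have Dint : D = (absz ((Posz lam - Posz mu) ^+ 2 + Posz 4 * (Posz k - Posz mu)))%:R.
    have h : 0 <= (Posz lam - Posz mu) ^+ 2 + Posz 4 * (Posz k - Posz mu).
      by rewrite addr_ge0 ?sqr_ge0 // mulr_ge0 // subr_ge0 lez_nat.
    rewrite pmulrn gez0_abs // !expr2 !(intrB, intrD, intrM) -!pmulrn.
    by rewrite /D expr2.
  have [n dn] := int_sqrt_of_rational d0 (etrans dD Dint) s0 st.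
  have nE : (n ^ 2 + 2 * (lam * mu) + 4 * mu = lam ^ 2 + mu ^ 2 + 4 * k)%N.
    apply/eqP; rewrite -(eqr_nat R) !natrD !natrM -dn -(expr2 d) dD /D; apply/eqP; ring.
  (* The parity of [d] is what makes its half-sums with [lam - mu] and [mu - lam] integers. *)
  have odn : odd n = odd (lam + mu).
    move/(congr1 odd): nE; rewrite !oddD !oddM.
    by case: (odd n); case: (odd lam); case: (odd mu); case: (odd k).
  have le1 : (mu <= lam + n)%N by rewrite -(ler_nat R) natrD -dn; lra.
  have le2 : (lam <= mu + n)%N by rewrite -(ler_nat R) natrD -dn; lra.
  exists (lam + n - mu)./2%N, (mu + n - lam)./2%N.
  have half2 (j : nat) : ~~ odd j -> j./2%:R = j%:R / 2 :> R.
    move=> oj; have := odd_double_half j; rewrite (negPf oj) add0n => {2}<-.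
    by rewrite -mul2n natrM; field.
  split; rewrite half2 ?oddB // ?oddD ?odn ?oddD ?natrB ?natrD -?dn //.
  - by rewrite /r; congr (_ / _); ring.
  - by case: (odd lam); case: (odd mu).
  - by rewrite /m; congr (_ / _); ring.
  by case: (odd lam); case: (odd mu).
have t0 : t = 0.
  by apply: (@intr_inj R); rewrite -st s0 mul0r.
(* [t = 0] reads [(|T| - 1) (mu - lam) = 2 k], and [0 < k < |T| - 1] leaves only [mu - lam = 1]. *)
have mulam : mu = lam.+1 by move: t0 kT muk mu0; rewrite /t; clear; move: #|T| => v; nia.
have T2 : #|T| = (2 * k).+1 by move: t0 kT muk mu0; rewrite /t mulam; clear; move: #|T| => v; nia.
have k2 : k = (2 * mu)%N.
  have Tr : #|T|%:R - 1 - k%:R = k%:R :> R by rewrite T2 -natr1 natrM; ring.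
  have mr : mu%:R = lam%:R + 1 :> R by rewrite mulam natr1.
  rewrite Tr mulrC in fe2; have E := mulfI (lt0r_neq0 k0) fe2.
  by apply/eqP; rewrite -(eqr_nat R) natrM; apply/eqP; lra.
by split=> //; rewrite T2 k2 mulnA.
Qed.

Section SmallMu.
Variables (T : finType) (e : rel T) (k lam mu r m : nat).
Hypotheses (esrg : srg e #|T| k lam mu) (kE : (k = mu + r * m)%N).
Hypotheses (lamE : (lam + m = mu + r)%N) (mumP : (0 < mu < m)%N).

Let m_gt0 : 0 < m%:R :> rat.
Proof. by rewrite ltr0n; case/andP: mumP => mu0; apply: ltn_trans. Qed.
Let r_ge0 : 0 <= r%:R :> rat. Proof. by rewrite ler0n. Qed.
Let rmE : r%:R * m%:R = k%:R - mu%:R :> rat.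
Proof. by rewrite kE natrD natrM addrC addKr. Qed.
Let rBm : r%:R - m%:R = lam%:R - mu%:R :> rat.
Proof.
by apply/eqP; rewrite subr_eq addrAC eq_sym subr_eq -!natrD eqr_nat lamE addnC.
Qed.

Lemma srg_feasibility_nat : (mu * #|T| = (k - r) * (k + m))%N.
Proof.
have rk : (r <= k)%N.
  by rewrite kE; apply: leq_trans (leq_addl _ _); apply: leq_pmulr; lia.
apply/eqP; rewrite -(eqr_nat rat) !natrM natrB // natrD; apply/eqP.
exact: (srg_feasibility esrg rmE rBm).
Qed.

(** As [mu <= m], the factor [r m + m - mu] is at least [r m] and [k - m] is at most [r m];
    cancelling [r m], positive because [r > lam], leaves the bound. *)
Lemma eigenvalue_le_of_krein : (m <= r.+1 ^ 2 + 1)%N.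
Proof.
have k0 : 0 < k%:R :> rat by rewrite ltr0n kE; lia.
have := krein_condition esrg rmE rBm r_ge0 m_gt0; rewrite ler_pM2r // => kr.
have mm : mu%:R <= m%:R :> rat by rewrite ler_nat; lia.
have m1 : 0 <= m%:R - 1 :> rat by rewrite subr_ge0 ler1n; lia.
have rgt : 0 < r%:R * m%:R :> rat.
  by rewrite mulr_gt0 // ltr0n; move: lamE mumP; case: (r) => //; lia.
have kr2 : (m%:R - 1) * (r%:R * m%:R) <= (r%:R + 1) ^+ 2 * (r%:R * m%:R) :> rat.
  apply: (@le_trans _ _ ((m%:R - 1) * (r%:R * m%:R + m%:R - mu%:R))).
    by rewrite ler_wpM2l // -addrA lerDl subr_ge0.
  apply: le_trans kr _; rewrite mulrC ler_wpM2l ?sqr_ge0 //.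
  by rewrite rmE lerD2l lerN2.
rewrite ler_pM2r // in kr2.
by rewrite -(ler_nat rat) natrD natrX -natr1; lra.
Qed.

Lemma eigenvalue_le_of_claw : (r <= 4 * m ^ 2 * mu)%N.
Proof. exact: claw_bound_eigenvalue mumP kE lamE (claw_bound esrg kE lamE mumP). Qed.

Theorem srg_hamiltonian_of_mu_lt : connected_graph e ->
  (80 * 1000 <= r)%N -> (80 * 1000 <= m)%N -> hamiltonian e.
Proof.
move=> conn Lr Lm; have mr : (m <= mu + r)%N by rewrite -lamE leq_addl.
have [q0 k4 kv v1000 vq] := mixing_arith (leqnn _) Lr Lm mumP kE
  eigenvalue_le_of_claw mr srg_feasibility_nat.
have [[esym eirr] [_ [deg _]]] := esrg.
have rM : r%:R <= (maxn r m)%:R :> rat by rewrite ler_nat leq_maxl.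
have mM : m%:R <= (maxn r m)%:R :> rat by rewrite ler_nat leq_maxr.
have s0 : 0 <= (minn r m)%:R :> rat by rewrite ler0n.
(* The product is [r m = k - mu], so [min(r, m)] bounds from below the ratio of [k] to the largest
   nontrivial eigenvalue. *)
have sM : (minn r m)%:R * (maxn r m)%:R <= k%:R :> rat.
  rewrite -natrM ler_nat kE; apply: leq_trans (leq_addl _ _).
  by case: (leqP r m) => _; rewrite // mulnC.
apply: (@hamiltonian_of_mixing T e k (minn r m ^ 2)) => //.
- move=> c S A hS hA; rewrite -(ler_nat rat) !natrM.
  exact: (srg_mixing_lower esrg rmE rBm r_ge0 m_gt0 rM mM s0 sM hS hA).
- move=> c S A hS hA; rewrite -(ler_nat rat) !natrM.
  exact: (srg_mixing_upper esrg rmE rBm r_ge0 m_gt0 rM mM s0 sM hS hA).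
Qed.
End SmallMu.

Local Close Scope ring_scope.

Theorem theorem0p1 :
  exists N : nat, forall (T : finType) (e : rel T),
    strongly_regular e -> connected_graph e -> N < #|T| -> hamiltonian e.
Proof.
have [N hN] := eigenvalues_large (80 * 1000).
(* For a conference graph, [|T| = 4 mu + 1 > 9] gives [mu > 2], hence [m > 2]. *)
exists (N + 9) => T e [k [lam [mu esrg]]] conn ltT.
have ltN : N < #|T| by apply: leq_ltn_trans ltT; apply: leq_addr.
have lt9 : 9 < #|T| by apply: leq_ltn_trans ltT; apply: leq_addl.
have mu0 := srg_mu_gt0 esrg conn.
(* A real closed field supplies the square root of the discriminant, possibly irrational for
   conference graphs. *)
have [r [m [rmE rBm r0 m1 cases]]] := srg_eigenvalues realalg esrg conn.
have m0 : (0 < m)%R by apply: lt_trans m1.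
have T3 : 3 <= #|T| by apply: leq_trans lt9.
case: cases => [[r' [m' [rE mE]]]|[muE kE TE]].
  have m2 : (2 <= m)%R by move: m1; rewrite mE ltr1n ler_nat.
  have [lt|le] := ltP (m - 1)%R mu%:R%R.
    exact: (srg_hamiltonian_of_mu_gt esrg rmE rBm r0 m0 mu0 T3 m2 lt).
  have mum : mu < m' by rewrite -(ler_nat realalg) -natr1 -mE -lerBrDr.
  have kE : k = mu + r' * m'.
    by apply/eqP; rewrite -(eqr_nat realalg) natrD natrM -rE -mE rmE addrC subrK.
  have lamE : lam + m' = mu + r'.
    by apply/eqP; rewrite -(eqr_nat realalg) !natrD -rE -mE; apply/eqP; lra.
  have mumP : 0 < mu < m' by rewrite mu0 mum.
  have [|Lr Lm] := hN r' m' mu k #|T| mumP kE (eigenvalue_le_of_claw esrg kE lamE mumP)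
    (eigenvalue_le_of_krein esrg kE lamE mumP) _ ltN.
    by rewrite (srg_feasibility_nat esrg kE lamE mumP) leq_mul2r leq_subr orbT.
  exact: srg_hamiltonian_of_mu_lt esrg kE lamE mumP conn Lr Lm.
have mu2 : 2 < mu by rewrite TE in lt9; lia.
have kr : (k%:R = 2 * mu%:R :> realalg)%R by rewrite kE natrM.
have lr : (mu%:R = lam%:R + 1 :> realalg)%R by rewrite muE natr1.
have mu2r : (2 < mu%:R :> realalg)%R by rewrite (ltr_nat _ 2).
have rm1 : (r = m - 1)%R by lra.
(* With [m > 1] this yields [m - 1 < mu], so the first method covers conference graphs. *)
have mm : ((m - 1) * m = mu%:R)%R by rewrite -rm1 rmE kr; ring.
by apply: (srg_hamiltonian_of_mu_gt esrg rmE rBm r0 m0 mu0 T3); nra.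
Qed.
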